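(* Let $P\subseteq\mathbb{P}^{n-1}$ be a full-dimensional polytope, let $1\le k\le n$, and let $V\in P^{[k]}_{\max}$. Then \[\mathcal{S}_P(V)=\{W\in\mathrm{Gr}(k,n)\mid \mathrm{sign}(\mathrm{C}_P^k|_{\mathcal{F}(V)}(V))\equiv \mathrm{sign}(\mathrm{C}_P^k|_{\mathcal{F}(V)}(W))\}.\]
   Context: Work over $\mathbb{R}$. $\mathrm{Gr}(k,n)$ is the Grassmannian of $k$-dimensional linear subspaces of $\mathbb{R}^n$; a subspace is identified with its image in $\mathbb{P}^{n-1}$. A polytope $P\subseteq\mathbb{P}^{n-1}$ is the image in $\mathbb{P}^{n-1}$ of a cone $\{\sum c_iv_i: c_i\ge0\}$ over finitely many $v_i\in\mathbb{R}^n$ (the projectivization of the cone over a polytope in an affine hyperplane not through the origin); faces and dimensions are those of that polytope. $P^{[k]}=\{V\in\mathrm{Gr}(k,n)\mid V\cap P\neq\emptyset\}$, and $P^{[k]}_{\max}=\{V\in P^{[k]}\mid V\cap G=\emptyset$ for every face $G$ of $P$ with $\dim G<n-k\}$. For $V\in P^{[k]}_{\max}$, the stabbing chamber is $\mathcal{S}_P(V)=\{W\in\mathrm{Gr}(k,n)\mid$ for every $(n-k)$-dimensional face $F$ of $P$: $W\cap\mathrm{relint}(F)\ne\emptyset \iff V\cap\mathrm{relint}(F)\neq\emptyset\}$, and $\mathcal{F}_P(V)$ is the set of $(n-k)$-dimensional faces $F$ of $P$ with $V\cap\mathrm{relint}(F)\ne\emptyset$. Chow forms: for $V\in\mathrm{Gr}(k,n)$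 and $I\in\binom{[n]}{n-k}$ let $p_I(V)$ be the maximal minor on columns $I$ of an $(n-k)\times n$ matrix with kernel $V$; fix an ordering $G_1,\ldots,G_f$ of the $(n-k-1)$-dimensional faces of $P$, for each $G_i$ choose $n-k$ linearly independent vertices (vectors in $\mathbb{R}^n$) of $G_i$ forming the rows of an $(n-k)\times n$ matrix $M^i$, and set $C_{G_i}(V)=\sum_{I} q_I(M^i)p_I(V)$ with $q_I(M^i)$ the maximal minor of $M^i$ on columns $I$. $\mathrm{C}_P^k=(C_{G_1},\ldots,C_{G_f})$, and $\mathrm{C}_P^k|_{\mathcal{F}(V)}$ is the subvector consisting of the $C_G$ with $G$ a facet of some $F\in\mathcal{F}_P(V)$. These vectors are defined up to a common nonzero scalar. For a real vector $x$, $\mathrm{sign}(x)\in\{+,0,-\}^N$ is its coordinatewise sign; for sign vectors, $\alpha\equiv\beta$ means $\alpha=\beta$ or $\alpha=-\beta$. *)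

(* Defs.v *)
(* Polytopes in P^{n-1} are handled through their cones in
   R^n = 'rV[R]_n, R an arbitrary realType (the reals).                      *)
From HB Require Import structures.
From mathcomp Require Import all_boot all_order all_algebra.
From mathcomp Require Import reals.
Set Implicit Arguments. Unset Strict Implicit. Unset Printing Implicit Defensive.
Import Order.TTheory GRing.Theory Num.Theory.
Local Open Scope ring_scope.

Section Defs.
Variables (R : realType) (n : nat).

Definition vset := 'rV[R]_n -> Prop.

Definition cone (m : nat) (v : 'I_m -> 'rV[R]_n) : vset :=
  fun x => exists c : 'I_m -> R, (forall i, 0 <= c i) /\ x = \sum_i c i *: v i.

(* the cone is the cone over a polytope in an affine hyperplane not through 0 *)
Definition pointed_gens (m : nat) (v : 'I_m -> 'rV[R]_n) : Prop :=
  exists l : 'cV[R]_n, forall i, 0 < (v i *m l) 0 0.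

(* F is a face of the (convex) set K: intersection of K with a supporting
   hyperplane through the origin (faces of the cone = cones over faces of the
   polytope; the empty face of the polytope corresponds to the face {0}). *)
Definition face_of (K F : vset) : Prop :=
  exists l : 'cV[R]_n, (forall x, K x -> 0 <= (x *m l) 0 0) /\
    (forall x, F x <-> (K x /\ (x *m l) 0 0 = 0)).

Definition cone_dim_ge (F : vset) (r : nat) : Prop :=
  exists A : 'M[R]_(r, n), row_free A /\ forall i, F (row i A).

(* dim (linear span of F) = r ; for a cone face this is
   (dimension of the corresponding polytope face) + 1 *)
Definition cone_dim (F : vset) (r : nat) : Prop :=
  cone_dim_ge F r /\ ~ cone_dim_ge F r.+1.

Definition span (F : vset) : vset :=
  fun y => exists r (A : 'M[R]_(r, n)), (forall i, F (row i A)) /\ (y <= A)%MS.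

(* relative interior of F (interior in its linear span = affine hull of the
   cone face, for the sup-norm topology) *)
Definition relint (F : vset) : vset :=
  fun x => F x /\ exists e : R, 0 < e /\
    forall y, span F y -> (forall j, `|y 0 j| < e) -> F (x + y).

Definition meets (k : nat) (V : 'M[R]_(k, n)) (F : vset) : Prop :=
  exists x : 'rV[R]_n, (x <= V)%MS /\ x != 0 /\ F x.

Definition meets_relint (k : nat) (V : 'M[R]_(k, n)) (F : vset) : Prop :=
  meets V (relint F).

(* P^[k]_max ; dim G < n-k  <->  span of cone face has dim <= n-k *)
Definition in_Pmax (m k : nat) (v : 'I_m -> 'rV[R]_n) (V : 'M[R]_(k, n)) :=
  meets V (cone v) /\
  forall G, face_of (cone v) G -> ~ cone_dim_ge G (n - k).+1 -> ~ meets V G.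

Definition stabbing (m k : nat) (v : 'I_m -> 'rV[R]_n) (V W : 'M[R]_(k, n)) :=
  forall F, face_of (cone v) F -> cone_dim F (n - k).+1 ->
    (meets_relint W F <-> meets_relint V F).

Definition is_vertex (m : nat) (v : 'I_m -> 'rV[R]_n) (x : 'rV[R]_n) :=
  x != 0 /\ exists F, face_of (cone v) F /\ cone_dim F 1 /\ F x.

Definition chow_choice (m k : nat) (v : 'I_m -> 'rV[R]_n)
    (M : vset -> 'M[R]_(n - k, n)) :=
  forall G, face_of (cone v) G -> cone_dim G (n - k) ->
    row_free (M G) /\ forall r, is_vertex v (row r (M G)) /\ G (row r (M G)).

Definition kernel_is (k : nat) (B : 'M[R]_(n - k, n)) (V : 'M[R]_(k, n)) :=
  forall x : 'rV[R]_n, (x *m B^T == 0) = (x <= V)%MS.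

(* sum over I in binom([n], p) of q_I(A) p_I(B); the p-subsets I are listed
   as strictly increasing maps 'I_p -> 'I_n *)
Definition chow_val (p : nat) (A B : 'M[R]_(p, n)) : R :=
  \sum_(f : {ffun 'I_p -> 'I_n} |
          [forall i : 'I_p, forall j : 'I_p, (i < j)%N ==> (f i < f j)%N])
     \det (colsub f A) * \det (colsub f B).

(* G indexes a coordinate of C_P^k|_{F(V)} *)
Definition in_FV (m k : nat) (v : 'I_m -> 'rV[R]_n) (V : 'M[R]_(k, n))
    (G : vset) :=
  face_of (cone v) G /\ cone_dim G (n - k) /\
  exists F, face_of (cone v) F /\ cone_dim F (n - k).+1 /\
    meets_relint V F /\ face_of F G.

Definition sign_equiv (m k : nat) (v : 'I_m -> 'rV[R]_n) (V : 'M[R]_(k, n))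
    (M : vset -> 'M[R]_(n - k, n)) (BV BW : 'M[R]_(n - k, n)) :=
  (forall G, in_FV v V G ->
     Num.sg (chow_val (M G) BV) = Num.sg (chow_val (M G) BW)) \/
  (forall G, in_FV v V G ->
     Num.sg (chow_val (M G) BV) = - Num.sg (chow_val (M G) BW)).

End Defs.

(* Main.v *)
Require Import Defs.
From HB Require Import structures.
From mathcomp Require Import all_boot all_order all_fingroup all_algebra.
From mathcomp Require Import boolp reals.
From mathcomp Require Import ring lra.
Set Implicit Arguments. Unset Strict Implicit. Unset Printing Implicit Defensive.
Import Order.TTheory GRing.Theory Num.Theory.
Local Open Scope ring_scope.

(** Write [d = n - k]. If [V] has no point on a face of cone dimension at most [d], then
    it cuts the span of each [(d+1)]-dimensional face [F] it stabs in a single line [<x>],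
    and for the facets [G] of [F] the sign of [C_G(V) = det (M_G B_V^T)] is, up to a sign
    independent of [G], the sign of the orientation of [(M_G, x)], i.e. of [l_G(x)] for
    the functional [l_G] cutting out [G]. Hence equal signs on the facets of [F], up to a
    global sign, mean that [W] stabs [F] too. Orientations of pairs of points
    compare in the same way the signs at two faces [F1, F2] that are stabbed inside a common
    [(d+2)]-dimensional face, i.e. at the two ends of an edge of the polytope [V :&: P]. The graph
    of this polytope is connected (simplex method), which makes the sign global; the same
    argument for [W :&: P] shows that [W] stabs no other face. That a [W] in the stabbing
    chamber of [V] is transversal to the span of each stabbed [F] follows because the
    cone is generated modulo [span F] by the faces covering [F], each of which [W] meets
    outside [F], at the other end of an edge. *)

(** * Linear functionals and the Farkas lemma *)

Section Functionals.
Variables (R : realType) (n : nat).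
Implicit Types (l : 'cV[R]_n) (x y : 'rV[R]_n).

Definition ev l x : R := (x *m l) 0 0.

Lemma ev_is_scalar l : scalar (ev l).
Proof. by move=> a x y; rewrite /ev mulmxDl -scalemxAl !mxE. Qed.
HB.instance Definition _ l := GRing.isLinear.Build R 'rV[R]_n R *%R (ev l) (ev_is_scalar l).

Lemma evDl l1 l2 x : ev (l1 + l2) x = ev l1 x + ev l2 x.
Proof. by rewrite /ev mulmxDr mxE. Qed.

Lemma evZl a l x : ev (a *: l) x = a * ev l x.
Proof. by rewrite /ev -scalemxAr mxE. Qed.

Lemma evNl l x : ev (- l) x = - ev l x.
Proof. by rewrite /ev mulmxN mxE. Qed.

Lemma ev0l x : ev 0 x = 0.
Proof. by rewrite /ev mulmx0 mxE. Qed.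

Lemma ev_suml (I : finType) (P : pred I) (F : I -> 'cV[R]_n) x :
  ev (\sum_(i | P i) F i) x = \sum_(i | P i) ev (F i) x.
Proof. by rewrite /ev mulmx_sumr summxE. Qed.

Lemma ev_mulmx (p : nat) (A : 'M[R]_(n, p)) (l : 'cV[R]_p) x :
  ev (A *m l) x = (x *m A *m l) 0 0.
Proof. by rewrite /ev mulmxA. Qed.

Lemma mulmx_ev l x : x *m l = (ev l x)%:M.
Proof. by rewrite [LHS]mx11_scalar. Qed.

Lemma ev_eq0 l x : (ev l x == 0) = (x *m l == 0).
Proof.
apply/eqP/eqP => [h|h]; last by rewrite /ev h mxE.
by rewrite mulmx_ev h; apply/matrixP=> i j; rewrite !mxE mul0rn.
Qed.

Lemma ev_sub0 (p : nat) l (A : 'M[R]_(p, n)) x :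
  (forall i, ev l (row i A) = 0) -> (x <= A)%MS -> ev l x = 0.
Proof.
move=> h /submxP[D ->]; rewrite mulmx_sum_row linear_sum big1 // => i _.
by rewrite linearZ /= h mulr0.
Qed.

Lemma separate (p : nat) (A : 'M[R]_(p, n)) x : ~~ (x <= A)%MS ->
  exists l, (forall y, (y <= A)%MS -> ev l y = 0) /\ 0 < ev l x.
Proof.
rewrite submxE => h.
have [j hj] : exists j, (x *m cokermx A) 0 j != 0.
  apply/existsP; apply: contraNT h; rewrite negb_exists => /forallP h.
  by apply/eqP/rowP=> j; rewrite [RHS]mxE; apply/eqP; move: (h j); rewrite negbK.
pose l := col j (cokermx A).
have evl y : ev l y = (y *m cokermx A) 0 j.
  by rewrite /ev /l !mxE; apply: eq_bigr => i _; rewrite !mxE.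
have l0 y : (y <= A)%MS -> ev l y = 0.
  by rewrite submxE => /eqP hy; rewrite evl hy mxE.
have [hp|hp] := ltrP 0 (ev l x); first by exists l.
exists (- l); split=> [y hy|]; first by rewrite evNl l0 ?oppr0.
by rewrite evNl oppr_gt0 lt_neqAle hp andbT evl.
Qed.

Lemma small_multiple y (e : R) : 0 < e ->
  exists2 a : R, 0 < a & forall j, `|(a *: y) 0 j| < e.
Proof.
move=> e0; pose N := 1 + \sum_j `|y 0 j|.
have N0 : 0 < N by rewrite ltr_pwDl // sumr_ge0.
exists (e / N) => [|j]; first by rewrite divr_gt0.
rewrite mxE normrM gtr0_norm ?divr_gt0 // mulrAC ltr_pdivrMr // ltr_pM2l //.
by rewrite /N (bigD1 j) //= addrCA ltrDl ltr_pwDl // sumr_ge0.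
Qed.

(** Induction on the number of generators. If the functional [l] obtained from the others is
    negative at the first generator [u], everything is projected along [u] onto the kernel of [l],
    where the induction hypothesis applies again. *)
Lemma farkas (m : nat) (v : 'I_m -> 'rV[R]_n) (b : 'rV[R]_n) :
  (exists c : 'I_m -> R, (forall i, 0 <= c i) /\ b = \sum_i c i *: v i) \/
  (exists l, (forall i, 0 <= ev l (v i)) /\ ev l b < 0).
Proof.
elim: m v b => [|m IH] v b.
  have [->|b0] := eqVneq b 0.
    by left; exists (fun=> 0); split=> //; rewrite big_ord0.
  right; have [|l [_ hl]] := @separate 0%N (0 : 'M[R]_(0, n)) b.
    by apply: contra b0 => /submxP[D ->]; rewrite (thinmx0 D) mul0mx.
  by exists (- l); split=> [[]//|]; rewrite evNl oppr_lt0.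
have [[c [c0 ->]]|[l [l0 lb]]] := IH (fun i => v (lift ord0 i)) b.
  left; exists (fun i => if unlift ord0 i is Some j then c j else 0).
  split=> [i|]; first by case: unliftP.
  rewrite big_ord_recl unlift_none scale0r add0r.
  by apply: eq_bigr => i _; rewrite liftK.
have [hp|hn] := lerP 0 (ev l (v ord0)).
  right; exists l; split=> // i.
  by case: (unliftP ord0 i) => [j|] ->.
pose u := v ord0; pose pr x := x - (ev l x / ev l u) *: u.
have [[c [c0 hb]]|[l' [l'0 l'b]]] := IH (fun i => pr (v (lift ord0 i))) (pr b).
  (* In total the projections of the other generators remove [s] copies of [u]. Since [s <= 0] and
     the projection of [b] removes a positive multiple of [u], the coefficient left for [u] is
     positive. *)
  left; pose s := \sum_i c i * (ev l (v (lift ord0 i)) / ev l u).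
  have s0 : s <= 0.
    apply: sumr_le0 => i _; apply: mulr_ge0_le0 => //.
    by apply: mulr_ge0_le0 => //; rewrite invr_le0 ltW.
  have t0 : 0 < ev l b / ev l u by rewrite nmulr_rgt0 ?invr_lt0.
  exists (fun i => if unlift ord0 i is Some j then c j else ev l b / ev l u - s).
  split=> [i|]; first by case: unliftP => // _; rewrite subr_ge0 (le_trans s0) ?ltW.
  rewrite big_ord_recl unlift_none.
  under eq_bigr => i _ do rewrite liftK.
  have eb : b = pr b + (ev l b / ev l u) *: u by rewrite /pr subrK.
  rewrite {1}eb hb.
  have -> : \sum_i c i *: pr (v (lift ord0 i)) = \sum_i c i *: v (lift ord0 i) - s *: u.
    under eq_bigr => i _ do rewrite /pr scalerBr scalerA.
    by rewrite big_split /= sumrN -scaler_suml.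
  by rewrite scalerBl -addrA addrC [- _ + _]addrC.
(* This is [l'] composed with [pr], hence zero at [u]. *)
right; pose l'' := l' - (ev l' u / ev l u) *: l.
have el x : ev l'' x = ev l' (pr x).
  rewrite /l'' /pr evDl evNl evZl linearB linearZ /=; ring.
exists l''; split; last by rewrite el.
move=> i; rewrite el; case: (unliftP ord0 i) => [j|] -> //.
by rewrite /pr divff ?lt_eqF// scale1r subrr linear0.
Qed.

End Functionals.

(** * Finitely generated cones *)

Section Cones.
Variables (R : realType) (n m : nat) (v : 'I_m -> 'rV[R]_n).
Implicit Types (l : 'cV[R]_n) (x y z : 'rV[R]_n) (J : {set 'I_m}).

Definition fcone J : vset R n := fun x =>
  exists c : 'I_m -> R, (forall i, 0 <= c i) /\ x = \sum_(i in J) c i *: v i.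

(** An algebraic form of the relative interior of [fcone J]; see [relint_fcone]. For [J = set0] it
    is the origin alone, so later statements ask separately for nonzero points. *)
Definition ripos J : vset R n := fun x =>
  exists c : 'I_m -> R, (forall i, 0 < c i) /\ x = \sum_(i in J) c i *: v i.

(** Zero rows stand for the generators outside [J], so that all these matrices have the same size;
    the row space is the span of the face. *)
Definition gen J : 'M[R]_(m, n) := \matrix_i (if i \in J then v i else 0).

Lemma row_gen J i : row i (gen J) = if i \in J then v i else 0.
Proof. by rewrite rowK. Qed.

Lemma v_gen J i : i \in J -> (v i <= gen J)%MS.
Proof. by move=> iJ; apply: (eq_row_sub i); rewrite row_gen iJ. Qed.

Lemma gen_sub (p : nat) (A : 'M[R]_(p, n)) J :
  (forall i, i \in J -> (v i <= A)%MS) -> (gen J <= A)%MS.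
Proof.
move=> h; apply/row_subP => i; rewrite row_gen; case: ifP => [/h//|_].
exact: sub0mx.
Qed.

Lemma gen_subset J J' : J \subset J' -> (gen J <= gen J')%MS.
Proof. by move/subsetP=> s; apply: gen_sub => i /s /v_gen. Qed.

Lemma mul_gen J (b : 'rV[R]_m) : b *m gen J = \sum_(i in J) b 0 i *: v i.
Proof.
rewrite mulmx_sum_row [RHS]big_mkcond; apply: eq_bigr => i _.
by rewrite row_gen; case: ifP; rewrite ?scaler0.
Qed.

Lemma sum_gen J (c : 'I_m -> R) : ((\sum_(i in J) c i *: v i)%R <= gen J)%MS.
Proof. by by apply: summx_sub => i iJ; apply: scalemx_sub; apply: v_gen. Qed.

Lemma fcone_gen J x : fcone J x -> (x <= gen J)%MS.
Proof. by case=> c [_ ->]; apply: sum_gen. Qed.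

Lemma ripos_fcone J x : ripos J x -> fcone J x.
Proof. by case=> c [c0 ->]; exists c; split=> // i; apply: ltW. Qed.

Lemma ripos_gen J x : ripos J x -> (x <= gen J)%MS.
Proof. by move/ripos_fcone/fcone_gen. Qed.

Lemma ev_gen0 J l y : (forall i, i \in J -> ev l (v i) = 0) ->
  (y <= gen J)%MS -> ev l y = 0.
Proof.
move=> h; apply: ev_sub0 => i; rewrite row_gen.
by case: ifP => [/h|_]; rewrite ?linear0.
Qed.

Lemma fcone0 J : fcone J 0.
Proof. by exists (fun=> 0); split=> //; rewrite big1 // => i _; rewrite scale0r. Qed.

Lemma fconeD J x y : fcone J x -> fcone J y -> fcone J (x + y).
Proof.
move=> [c [c0 ->]] [d [d0 ->]]; exists (fun i => c i + d i).
by split=> [i|]; [rewrite addr_ge0|rewrite -big_split; apply: eq_bigr => i _; rewrite scalerDl].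
Qed.

Lemma fconeZ J a x : 0 <= a -> fcone J x -> fcone J (a *: x).
Proof.
move=> a0 [c [c0 ->]]; exists (fun i => a * c i).
split=> [i|]; first by rewrite mulr_ge0.
by rewrite scaler_sumr; apply: eq_bigr => i _; rewrite scalerA.
Qed.

Lemma riposZ J a x : 0 < a -> ripos J x -> ripos J (a *: x).
Proof.
move=> a0 [c [c0 ->]]; exists (fun i => a * c i).
split=> [i|]; first by rewrite mulr_gt0.
by rewrite scaler_sumr; apply: eq_bigr => i _; rewrite scalerA.
Qed.

Lemma fcone_v J i : i \in J -> fcone J (v i).
Proof.
move=> iJ; exists (fun j => (j == i)%:R); split=> [j|]; first by rewrite ler0n.
rewrite (bigD1 i) //= eqxx scale1r big1 ?addr0 // => j /andP[_ /negPf->].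
by rewrite scale0r.
Qed.

Lemma fconeS J J' x : J \subset J' -> fcone J x -> fcone J' x.
Proof.
move=> /subsetP s [c [c0 ->]]; exists (fun i => if i \in J then c i else 0).
split=> [i|]; first by case: ifP.
rewrite [RHS]big_mkcond [LHS]big_mkcond; apply: eq_bigr => i _.
by case: ifP => [/s ->//|_]; rewrite scale0r if_same.
Qed.

Lemma ev_fcone_ge0 J l x : (forall i, i \in J -> 0 <= ev l (v i)) ->
  fcone J x -> 0 <= ev l x.
Proof.
move=> h [c [c0 ->]]; rewrite linear_sum sumr_ge0 // => i iJ.
by rewrite linearZ mulr_ge0 ?h.
Qed.

Lemma ripos_ev0 J l x : (forall i, i \in J -> 0 <= ev l (v i)) ->
  ripos J x -> ev l x = 0 -> forall i, i \in J -> ev l (v i) = 0.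
Proof.
move=> h [c [c0 ->]]; rewrite linear_sum => /psumr_eq0P e i iJ.
have: ev l (c i *: v i) = 0.
  by apply: e => // j jJ; rewrite linearZ mulr_ge0 ?h// ltW.
by rewrite linearZ => /eqP; rewrite mulf_eq0 gt_eqF //= => /eqP.
Qed.

Lemma ripos_ev_gt0 J l x i : (forall i, i \in J -> 0 <= ev l (v i)) ->
  ripos J x -> i \in J -> 0 < ev l (v i) -> 0 < ev l x.
Proof.
move=> h rx iJ hi; rewrite lt_neqAle (ev_fcone_ge0 h (ripos_fcone rx)) andbT eq_sym.
apply: contraTneq hi => /(ripos_ev0 h rx) /(_ _ iJ) ->.
by rewrite ltxx.
Qed.

(* the perturbation is uniform over a box, as the sup-norm [relint] requires *)
Lemma ripos_nbhs J x : ripos J x -> exists2 e : R, 0 < e &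
  forall y, (y <= gen J)%MS -> (forall j, `|y 0 j| < e) -> ripos J (x + y).
Proof.
case=> c [c0 ->]; pose P := pinvmx (gen J).
pose N i := 1 + \sum_j `|P j i|.
have N0 i : 0 < N i by rewrite ltr_pwDl // sumr_ge0.
(* The vector [y *m P] holds coefficients of [y] on the generators in [J], and this [e] keeps its
   entry [i] below [c i] in absolute value. The initial value [1] keeps [e] positive when there are
   no generators. *)
pose e := \big[Order.min/1]_(i < m) (c i / N i).
have e0 : 0 < e.
  by rewrite /e; elim/big_ind: _ => // [a b a0 b0|i _]; rewrite ?lt_min ?a0 // divr_gt0.
have ei i : e <= c i / N i by rewrite /e (bigD1 i) //= ge_min lexx.
exists e => // y yJ ye; exists (fun i => c i + (y *m P) 0 i); split=> [i|].
  suff: `|(y *m P) 0 i| < c i by rewrite ltr_norml => /andP[]; lra.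
  rewrite -(divfK (lt0r_neq0 (N0 i)) (c i)).
  apply: (le_lt_trans _ (y := e * (\sum_j `|P j i|))).
    rewrite mxE mulr_sumr (le_trans (ler_norm_sum _ _ _)) // ler_sum // => j _.
    by rewrite normrM ler_wpM2r // ltW.
  apply: lt_le_trans (_ : e * N i <= _); last by rewrite ler_wpM2r // ltW.
  by rewrite ltr_pM2l // /N ltrDr.
under [RHS]eq_bigr => i _ do rewrite scalerDl.
by rewrite big_split /= -mul_gen mulmxKpV.
Qed.

Lemma ripos_absorb J x y : ripos J x -> (y <= gen J)%MS ->
  exists2 e : R, 0 < e & ripos J (x + e *: y).
Proof.
move=> /ripos_nbhs [e e0 h] yJ; have [a a0 ha] := small_multiple y e0.
by exists a => //; apply: h => //; apply: scalemx_sub.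
Qed.

Lemma ripos_absorb_large J x y : ripos J x -> (y <= gen J)%MS ->
  exists2 N : R, 0 < N & ripos J (N *: x + y).
Proof.
move=> rx yJ; have [e e0 h] := ripos_absorb rx yJ.
exists e^-1; first by rewrite invr_gt0.
have := riposZ (a := e^-1) _ h; rewrite invr_gt0 scalerDr scalerA => /(_ e0).
by rewrite mulVf ?scale1r // gt_eqF.
Qed.

Lemma fcone_separate J y : ~ fcone J y ->
  exists l, (forall i, i \in J -> 0 <= ev l (v i)) /\ ev l y < 0.
Proof.
move=> nJ; have [[c [c0 hy]]|[l [l0 ly]]] := farkas (fun i => row i (gen J)) y.
  case: nJ; exists c; split=> //; rewrite hy [RHS]big_mkcond.
  by apply: eq_bigr => i _; rewrite row_gen; case: ifP; rewrite ?scaler0.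
by exists l; split=> // i iJ; move: (l0 i); rewrite row_gen iJ.
Qed.

End Cones.

(** * Faces *)

Section Faces.
Variables (R : realType) (n m : nat) (v : 'I_m -> 'rV[R]_n).
Variables (h : 'cV[R]_n) (h_gt0 : forall i, 0 < ev h (v i)).
Implicit Types (l : 'cV[R]_n) (x y z : 'rV[R]_n) (J F G : {set 'I_m}).

Local Notation gen := (gen v).
Local Notation fcone := (fcone v).
Local Notation ripos := (ripos v).

(** A face is encoded by the set of all generators lying on it, which turns inclusion and equality
    of faces into those of finite sets. *)
Definition isface J := exists l, (forall i, 0 <= ev l (v i)) /\
  forall i, (i \in J) = (ev l (v i) == 0).

(** This is the linear dimension, one more than the dimension of the polytope face. *)
Definition rk J := \rank (gen J).

Lemma isface_setT : isface setT.
Proof. by exists 0; split=> i; rewrite ?inE ev0l ?eqxx. Qed.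

Lemma isface_set0 : isface set0.
Proof. by exists h; split=> i; [rewrite ltW|rewrite inE gt_eqF]. Qed.

Lemma rk_set0 : rk set0 = 0%N.
Proof. by apply/eqP; rewrite mxrank_eq0 -submx0; apply: gen_sub => i; rewrite inE. Qed.

Lemma fcone_gt0 J x : fcone J x -> x != 0 -> 0 < ev h x.
Proof.
move=> cx; rewrite lt_neqAle.
have -> : 0 <= ev h x by apply: ev_fcone_ge0 cx => i _; apply: ltW.
rewrite andbT; apply: contraNneq => /esym; case: cx => c [c0 ->].
rewrite linear_sum => /psumr_eq0P e; apply/eqP/big1 => i iJ.
have: ev h (c i *: v i) = 0.
  by apply: e => // j _; rewrite linearZ /= mulr_ge0 // ltW.
rewrite linearZ => /eqP; rewrite mulf_eq0 (gt_eqF (h_gt0 i)) orbF => /eqP->.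
by rewrite scale0r.
Qed.

Lemma fcone_opp J x : fcone J x -> fcone J (- x) -> x = 0.
Proof.
move=> cx cNx; apply: contraTeq isT => x0.
have := fcone_gt0 cx x0; have := fcone_gt0 cNx; rewrite oppr_eq0 => /(_ x0).
by rewrite linearN /= => a b; exfalso; lra.
Qed.

(* faces of a face are faces: add a large multiple of a functional exposing [J] *)
Lemma isface_restrict J l : isface J -> (forall i, i \in J -> 0 <= ev l (v i)) ->
  isface [set i in J | ev l (v i) == 0].
Proof.
move=> [lJ [lJ0 JE]] l0; pose N := 1 + \sum_i `|ev l (v i)| / ev lJ (v i).
have out i : i \notin J -> 0 < ev (l + N *: lJ) (v i).
  rewrite JE => hi; have a0 : 0 < ev lJ (v i) by rewrite lt_neqAle eq_sym hi lJ0.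
  rewrite evDl evZl.
  have : ev lJ (v i) + `|ev l (v i)| <= N * ev lJ (v i).
    rewrite mulrDl mul1r lerD2l (bigD1 i) //= mulrDl divfK ?gt_eqF//.
    rewrite lerDl mulr_ge0 ?(ltW a0)// sumr_ge0 // => j _.
    by rewrite mulr_ge0 // invr_ge0.
  have := ler_norm (- ev l (v i)); rewrite normrN; lra.
have ins i : i \in J -> ev (l + N *: lJ) (v i) = ev l (v i).
  by rewrite JE => /eqP e; rewrite evDl evZl e mulr0 addr0.
exists (l + N *: lJ); split=> i; have [iJ|iJ] := boolP (i \in J).
- by rewrite ins ?l0.
- by rewrite ltW ?out.
- by rewrite ins // inE iJ.
- by rewrite (gt_eqF (out i iJ)) inE (negPf iJ).
Qed.

(** Ratio test: with [lG] exposing [G], let [t] be the largest ratio of [- l] to [lG] among the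
    generators of [J] where [l] is negative. Then [l + t *: lG] is nonnegative on [J] and vanishes
    on [G] and at a maximizer; where it vanishes outside [G], [l] equals [- t] times a positive
    number. *)
Lemma face_tilt G J l j : isface G -> isface J -> G \subset J ->
  (forall i, i \in G -> ev l (v i) = 0) -> j \in J -> ev l (v j) < 0 ->
  exists F, [/\ isface F, G \subset F, F \subset J,
    exists2 i, i \in F & i \notin G &
    forall i, i \in F -> i \notin G -> ev l (v i) < 0].
Proof.
move=> [lG [lG0 GE]] fJ GJ l0 jJ lj.
have pos i : i \notin G -> 0 < ev lG (v i) by rewrite GE lt_neqAle eq_sym lG0 andbT.
have neg_out i : ev l (v i) < 0 -> i \notin G.
  by apply: contraTN => /l0->; rewrite ltxx.
pose P i := (i \in J) && (ev l (v i) < 0).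
have Pj : P j by rewrite /P jJ lj.
pose f i := - ev l (v i) / ev lG (v i).
case: (@arg_maxP _ _ _ j P f Pj) => i0 /andP[i0J li0] imax; pose t := f i0.
have t0 : 0 < t by rewrite /t /f divr_gt0 ?oppr_gt0 ?pos ?neg_out.
pose l' := l + t *: lG.
have l'E i : ev l' (v i) = ev l (v i) + t * ev lG (v i) by rewrite evDl evZl.
have l'0 i : i \in J -> 0 <= ev l' (v i).
  move=> iJ; rewrite l'E; have [p|ng] := lerP 0 (ev l (v i)).
    by rewrite addr_ge0 // mulr_ge0 // ltW.
  have := imax i; rewrite /P iJ ng => /(_ isT) /=.
  rewrite -/t /f ler_pdivrMr ?pos ?neg_out //; lra.
exists [set i in J | ev l' (v i) == 0]; split.
- exact: isface_restrict.
- apply/subsetP => i iG; rewrite inE (subsetP GJ) //= l'E l0 // add0r.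
  by move: iG; rewrite GE => /eqP->; rewrite mulr0.
- by apply/subsetP => i; rewrite inE => /andP[].
- exists i0; last exact: neg_out.
  have nz := lt0r_neq0 (pos _ (neg_out _ li0)).
  by rewrite inE i0J l'E /t /f divfK // subrr eqxx.
- move=> i; rewrite inE l'E => /andP[iJ /eqP e] /pos p.
  by have := mulr_gt0 t0 p; lra.
Qed.

Lemma face_notin_gen G i : isface G -> i \notin G -> ~~ (v i <= gen G)%MS.
Proof.
move=> [lG [lG0 GE]]; rewrite GE; apply: contra => s; apply/eqP.
by apply: ev_gen0 s => j; rewrite GE => /eqP.
Qed.

Lemma rkS G J : G \subset J -> (rk G <= rk J)%N.
Proof. by move/(gen_subset v)/mxrankS. Qed.

Lemma rk_lt G J : isface G -> G \proper J -> (rk G < rk J)%N.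
Proof.
move=> fG /properP[s [i iJ iG]]; apply: rank_ltmx; rewrite ltmxE gen_subset //=.
by apply: contra (face_notin_gen fG iG); apply: submx_trans; apply: v_gen.
Qed.

Lemma face_eq G J : isface G -> G \subset J -> rk G = rk J -> G = J.
Proof.
move=> fG s e; apply/eqP; case: (eqVproper s) => [->//|/(rk_lt fG)].
by rewrite e ltnn.
Qed.

(** A functional vanishing on [G] and at one generator [i0] of [J] outside [G], but not on all of
    [J], is used to tilt. The face obtained is larger than [G] and still misses [i0]. *)
Lemma face_between G J : isface G -> isface J -> G \subset J ->
  ((rk G).+1 < rk J)%N -> exists F, [/\ isface F, G \proper F & F \proper J].
Proof.
move=> fG fJ GJ hr.
have [i0 i0J i0G] : exists2 i, i \in J & i \notin G.
  apply/subsetPn; apply: contraTN hr => /rkS s.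
  by rewrite -leqNgt (leq_trans s).
have [j jJ hj] : exists2 j, j \in J & ~~ (v j <= gen G + v i0)%MS.
  suff: ~~ [forall (j | j \in J), (v j <= gen G + v i0)%MS].
    by rewrite negb_forall_in => /exists_inP.
  apply: contraTN hr => /forall_inP s; rewrite -leqNgt.
  apply: leq_trans (mxrankS (gen_sub s)) _.
  apply: leq_trans (mxrank_adds_leqif _ _) _.
  by rewrite -[(rk G).+1]addn1 leq_add2l rank_leq_row.
have [l [l0 lj]] := separate hj.
have [|||F [fF GF FJ [i iF iG] neg]] := @face_tilt G J (- l) j fG fJ GJ.
- by move=> i iG; rewrite evNl l0 ?oppr0 // (submx_trans (v_gen v iG)) ?addsmxSl.
- by [].
- by rewrite evNl oppr_lt0.
exists F; split=> //; apply/properP; split=> //; first by exists i.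
exists i0 => //; apply/negP => /neg /(_ i0G).
by rewrite evNl l0 ?oppr0 ?ltxx // addsmxSr.
Qed.

(** The face lattice is graded by rank: intermediate faces are inserted until the rank [r] is
    reached. This yields both facets and covers. *)
Lemma face_interpolate G J r : isface G -> isface J -> G \subset J ->
  (rk G <= r <= rk J)%N -> exists F, [/\ isface F, G \subset F, F \subset J & rk F = r].
Proof.
have [d] := ubnP (rk J - rk G); elim: d G J => // d IH G J hd fG fJ GJ /andP[h1 h2].
have [e|n1] := eqVneq (rk G) r; first by exists G.
have [e|n2] := eqVneq (rk J) r; first by exists J.
have [|F [fF GF FJ]] := @face_between G J fG fJ GJ.
  apply: (@leq_ltn_trans r); first by rewrite ltn_neqAle n1.
  by rewrite ltn_neqAle eq_sym n2.
have a1 := rk_lt fG GF; have a2 := rk_lt fF FJ.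
have [le|lt] := leqP r (rk F).
  have [||F' [? ? s ?]] := IH G F _ fG fF (proper_sub GF).
  - by rewrite -ltnS; apply: leq_trans hd; rewrite ltnS ltn_sub2r // (ltn_trans a1).
  - by rewrite h1.
  by exists F'; split=> //; rewrite (subset_trans s) ?proper_sub.
have [||F' [? s ? ?]] := IH F J _ fF fJ (proper_sub FJ).
- by rewrite -ltnS; apply: leq_trans hd; rewrite ltnS ltn_sub2l // (ltn_trans a1).
- by rewrite (ltnW lt).
by exists F'; split=> //; rewrite (subset_trans (proper_sub GF)).
Qed.

(* Dual form of: the cone is generated modulo the span of [G] by the faces covering [G]. *)
Lemma face_cover_ge0 G l : isface G -> (forall i, i \in G -> ev l (v i) = 0) ->
  (forall F, isface F -> G \subset F -> rk F = (rk G).+1 ->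
     forall i, i \in F -> 0 <= ev l (v i)) ->
  forall i, 0 <= ev l (v i).
Proof.
move=> fG l0 cov i; rewrite leNgt; apply/negP => li.
have [F [fF GF _ [j jF jG] neg]] := face_tilt fG isface_setT (subsetT G) l0 (in_setT i) li.
have lt : (rk G < rk F)%N by apply: rk_lt => //; apply/properP; split=> //; exists j.
have [|F' [fF' GF' F'F e]] := @face_interpolate G F (rk G).+1 fG fF GF.
  by rewrite leqnSn.
have [a aF' aG] : exists2 a, a \in F' & a \notin G.
  by apply/subsetPn; apply: contraTN (leqnn (rk F')) => /rkS; rewrite -ltnNge e.
have := cov F' fF' GF' e a aF'; rewrite leNgt => /negP; apply.
exact: neg (subsetP F'F _ aF') aG.
Qed.

(** The face consists of the generators of which a positive multiple can be subtracted from [x]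
    without leaving the cone. Each other generator has a functional [l i] that is nonnegative on the
    cone, zero at [x] and positive at [v i]; the sum of these functionals exposes the face. *)
Lemma minface J x : fcone J x -> exists2 F, isface F & ripos F x.
Proof.
move=> /(fconeS (subsetT J)) cx.
pose I := [set i | `[< exists2 e, 0 < e & fcone setT (x - e *: v i) >]].
have /choice [l hl] i : exists l, (forall j, 0 <= ev l (v j)) /\ ev l x = 0 /\
    (i \notin I -> 0 < ev l (v i)).
  have [iI|iI] := boolP (i \in I).
    by exists 0; split=> [j|]; rewrite ev0l.
  (* A representation of [- v i] by the generators and [- x] would put [i] into [I]; the coefficient
     of [x] cannot be zero there because the cone is pointed. The other alternative gives the
     functional, zero at [x] because it is nonnegative at both [x] and [- x]. *)
  have [[c [c0 hc]]|[l [l0 lv]]] := farkas (fun j : 'I_m.+1 =>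
      if unlift ord0 j is Some a then v a else - x) (- v i); last first.
    have lj j : 0 <= ev l (v j) by have := l0 (lift ord0 j); rewrite liftK.
    exists l; split=> //; split=> [|_]; last by move: lv; rewrite linearN /= oppr_lt0.
    have := l0 ord0; rewrite unlift_none linearN /= oppr_ge0 => a.
    by apply/le_anti; rewrite a (ev_fcone_ge0 _ cx).
  case/negP: iI; rewrite inE; apply/asboolP.
  move: hc; rewrite big_ord_recl unlift_none.
  under eq_bigr => j _ do rewrite liftK.
  set s := \sum_j _ => hc.
  have cs : fcone setT s.
    exists (fun j => c (lift ord0 j)); split=> //.
    by apply: eq_bigl => j; rewrite inE.
  have xs : c ord0 *: x = s + v i.
    by rewrite -[v i]opprK hc scalerN opprD opprK addrCA subrr addr0.
  have [c00|cp] := eqVneq (c ord0) 0.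
    have e : s = - v i.
      by apply/eqP; rewrite -subr_eq0 opprK -xs c00 scale0r.
    have vi0 : v i = 0.
      by apply: (@fcone_opp setT); [apply: fcone_v|rewrite -e].
    by have := h_gt0 i; rewrite vi0 linear0 ltxx.
  have cp' : 0 < c ord0 by rewrite lt_neqAle eq_sym cp c0.
  exists (c ord0)^-1; first by rewrite invr_gt0.
  have -> : x - (c ord0)^-1 *: v i = (c ord0)^-1 *: s.
    by rewrite -[x](scalerK cp) xs -scalerBr addrK.
  by apply: fconeZ cs; rewrite invr_ge0 ltW.
(* At [x - e *: v j], a point of the cone, [l i] takes the value [- e * ev (l i) (v j)], which is
   therefore nonnegative. *)
have lI i j : j \in I -> ev (l i) (v j) = 0.
  rewrite inE => /asboolP[e e0 /(@ev_fcone_ge0 _ _ _ _ _ (l i))].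
  have [l0 [lx _]] := hl i => /(_ (fun a _ => l0 a)).
  rewrite linearB linearZ /= lx sub0r oppr_ge0 pmulr_rle0 // => a.
  by apply/le_anti; rewrite a l0.
exists I.
  exists (\sum_i l i); split=> [i|i].
    by rewrite ev_suml sumr_ge0 // => j _; case: (hl j).
  rewrite ev_suml; have [iI|iI] := boolP (i \in I).
    by rewrite big1 ?eqxx // => j _; apply: lI.
  apply/esym/negbTE; rewrite gt_eqF // (bigD1 i) //= ltr_pwDl //.
    by have [_ [_ /(_ iI)]] := hl i.
  by rewrite sumr_ge0 // => j _; case: (hl j).
have /choice [e he] i : exists e, 0 < e /\ (i \in I -> fcone setT (x - e *: v i)).
  have [|_] := boolP (i \in I); last by exists 1.
  by rewrite inE => /asboolP[e e0 ?]; exists e.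
pose k : R := #|I|.+1%:R.
have k0 : 0 < k by rewrite ltr0n.
(* averaging [x = e_i v_i + (x - e_i v_i)] over [i] in [I] together with [x = x] *)
have cs : fcone setT (k *: x - \sum_(i in I) e i *: v i).
  have -> : k *: x - \sum_(i in I) e i *: v i = x + \sum_(i in I) (x - e i *: v i).
    by rewrite big_split /= sumrN addrA sumr_const /k scaler_nat mulrS.
  apply: fconeD => //; elim/big_ind: _ => [|a b|i iI]; [exact: fcone0|exact: fconeD|].
  by case: (he i) => _; apply.
case: cs => c [c0 hc].
have cI i : i \notin I -> c i = 0.
  move=> iI; have [l0 [lx /(_ iI) li]] := hl i.
  have : ev (l i) (k *: x - \sum_(i in I) e i *: v i) = 0.
    rewrite linearB linearZ /= lx mulr0 sub0r linear_sum big1 ?oppr0 // => j jI.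
    by rewrite linearZ /= lI ?mulr0.
  rewrite hc linear_sum => /psumr_eq0P e0.
  have: ev (l i) (c i *: v i) = 0.
    by apply: e0 => [j _|]; rewrite ?inE // linearZ /= mulr_ge0.
  by rewrite linearZ => /eqP; rewrite mulf_eq0 (gt_eqF li) orbF => /eqP.
exists (fun i => k^-1 * (c i + e i)); split=> [i|].
  by rewrite mulr_gt0 ?invr_gt0 // ltr_wpDl //; case: (he i).
have -> : x = k^-1 *: (k *: x) by rewrite scalerK ?gt_eqF.
have -> : k *: x = \sum_(i in I) c i *: v i + \sum_(i in I) e i *: v i.
  rewrite -[LHS](subrK (\sum_(i in I) e i *: v i)) hc; congr (_ + _).
  rewrite [RHS]big_mkcond; apply: eq_big => i; rewrite ?in_setT // => _.
  by case: ifPn => // /cI->; rewrite scale0r.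
rewrite -big_split scaler_sumr; apply: eq_bigr => i _ /=.
by rewrite -scalerDl scalerA.
Qed.

Lemma face_ripos_sub F J x : isface J -> fcone J x -> ripos F x -> F \subset J.
Proof.
move=> [l [l0 JE]] cx rx; apply/subsetP => i iF; rewrite JE; apply/eqP.
apply: (ripos_ev0 _ rx) iF => //.
by apply: (ev_gen0 _ (fcone_gen cx)) => j; rewrite JE => /eqP.
Qed.

(** Rank count: the kernel of [l] cuts the span of [J] in a proper subspace containing the span of
    [G], and the latter already has codimension one. *)
Lemma facet_gen G J l i x : G \subset J -> (forall j, j \in G -> ev l (v j) = 0) ->
  rk J = (rk G).+1 -> i \in J -> ev l (v i) != 0 ->
  (x <= gen J)%MS -> ev l x = 0 -> (x <= gen G)%MS.
Proof.
move=> GJ l0 e iJ li xJ lx.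
have s : (gen G <= gen J :&: kermx l)%MS.
  rewrite sub_capmx gen_subset //=; apply: gen_sub => j jG.
  by apply/sub_kermxP/eqP; rewrite -ev_eq0 l0.
suff: (gen J :&: kermx l <= gen G)%MS.
  apply: submx_trans; rewrite sub_capmx xJ /=.
  by apply/sub_kermxP/eqP; rewrite -ev_eq0 lx.
rewrite -(mxrank_leqif_sup s); apply/eqP/anti_leq; rewrite mxrankS //= -ltnS.
rewrite -[(\rank (gen G)).+1]e; apply: rank_ltmx; rewrite ltmxE capmxSl /=.
apply: contra li => /(submx_trans (v_gen v iJ)).
by rewrite sub_capmx => /andP[_ /sub_kermxP/eqP]; rewrite -ev_eq0.
Qed.

(** The witness is the supremum of the times spent in the cone, finite because a functional
    separates [y] from the cone. If the endpoint lay outside, a functional separating it would give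
    a smaller upper bound; if it were interior, the ray could be prolonged. *)
Lemma exit_ray J x y : fcone J x -> (y <= gen J)%MS -> ~ fcone J y ->
  exists t, [/\ 0 <= t, fcone J (x + t *: y) & ~ ripos J (x + t *: y)].
Proof.
move=> cx yJ ny; pose E : R -> Prop := fun t => 0 <= t /\ fcone J (x + t *: y).
have E0 : E 0 by split=> //; rewrite scale0r addr0.
have bound l t : (forall i, i \in J -> 0 <= ev l (v i)) -> ev l y < 0 -> E t ->
    t <= ev l x / - ev l y.
  move=> l0 ly [t0 /(ev_fcone_ge0 l0)]; rewrite linearD linearZ /= => hh.
  by rewrite ler_pdivlMr ?oppr_gt0 //; lra.
have [l0 [l00 l0y]] := fcone_separate ny.
have supE : classical_sets.has_sup E.
  split; first by exists 0.
  by exists (ev l0 x / - ev l0 y) => t /(bound l0 t l00 l0y).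
have ub t : E t -> t <= sup E by move=> Et; apply: sup_upper_bound.
have s0 : 0 <= sup E by apply: ub.
have cs : fcone J (x + sup E *: y).
  apply: contrapT => /fcone_separate[l [lJ]]; rewrite linearD linearZ /= => neg.
  have lx := ev_fcone_ge0 lJ cx.
  have ly : ev l y < 0.
    by rewrite ltNge; apply/negP => /(mulr_ge0 s0); lra.
  have : sup E <= ev l x / - ev l y.
    by apply: ge_sup => [|t]; [exists 0|apply: bound].
  rewrite ler_pdivlMr ?oppr_gt0 //; lra.
exists (sup E); split=> // rs.
have [e e0 /ripos_fcone] := ripos_absorb rs yJ.
rewrite -addrA -scalerDl => ce.
have : E (sup E + e) by split=> //; rewrite addr_ge0 // ltW.
by move/ub; lra.
Qed.

Lemma exit_face J x y : isface J -> fcone J x -> (y <= gen J)%MS -> ~ fcone J y ->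
  exists t F, [/\ 0 <= t, isface F, F \proper J & ripos F (x + t *: y)].
Proof.
move=> fJ cx yJ ny; have [t [t0 ct nt]] := exit_ray cx yJ ny.
have [F fF rF] := minface ct; exists t, F; split=> //.
rewrite properEneq (face_ripos_sub fJ ct rF) andbT.
by apply/eqP => e; apply: nt; rewrite -e.
Qed.

End Faces.

(** * Faces stabbed by a subspace *)

Section Stabbing.
Variables (R : realType) (n m : nat) (v : 'I_m -> 'rV[R]_n).
Variables (h : 'cV[R]_n) (h_gt0 : forall i, 0 < ev h (v i)).
Hypothesis full : rk v setT = n.
Implicit Types (l : 'cV[R]_n) (x y z : 'rV[R]_n) (J F G : {set 'I_m}).

Local Notation gen := (gen v).
Local Notation fcone := (fcone v).
Local Notation ripos := (ripos v).
Local Notation isface := (isface v).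
Local Notation rk := (rk v).

Definition hits (k : nat) (V : 'M[R]_(k, n)) J :=
  exists x, [/\ (x <= V)%MS, x != 0 & ripos J x].

Definition stabbed (k : nat) (V : 'M[R]_(k, n)) (d : nat) J :=
  [/\ isface J, rk J = d.+1 & hits V J].

(** For [d = n - k], rank at most [d] means polytope dimension less than [n - k], as in the
    definition of the maximal part of the stabbing set. *)
Definition avoids (k : nat) (V : 'M[R]_(k, n)) (d : nat) :=
  forall G x, isface G -> (rk G <= d)%N -> (x <= V)%MS -> fcone G x -> x = 0.

(** As the ranks add up to [n + 1], the sum is the whole space exactly when the intersection is a
    line; [transversal_line] is the converse direction. *)
Lemma line_transversal (k : nat) (W : 'M[R]_(k, n)) J x :
  (\rank W + rk J = n.+1)%N ->
  (forall y, (y <= W)%MS -> (y <= gen J)%MS -> (y <= x)%MS) ->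
  (1%:M <= W + gen J)%MS.
Proof.
move=> e line; rewrite sub1mx -col_leq_rank.
have cap : (\rank (W :&: gen J) <= 1)%N.
  apply: leq_trans (rank_leq_row x); apply/mxrankS/row_subP => i.
  by have := row_sub i (W :&: gen J)%MS; rewrite sub_capmx => /andP[/line]; apply.
have := mxrank_sum_cap W (gen J); rewrite [X in _ = X]e => e'.
by rewrite -ltnS -e' -addn1 leq_add2l.
Qed.

Lemma transversal_line (k : nat) (W : 'M[R]_(k, n)) J x :
  (\rank W + rk J = n.+1)%N -> (1%:M <= W + gen J)%MS ->
  (x <= W)%MS -> (x <= gen J)%MS -> x != 0 ->
  forall y, (y <= W)%MS -> (y <= gen J)%MS -> (y <= x)%MS.
Proof.
rewrite sub1mx -col_leq_rank => e tr xW xJ x0 y yW yJ.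
have s : (x <= W :&: gen J)%MS by rewrite sub_capmx xW.
apply: (@submx_trans _ _ _ _ _ _ (W :&: gen J)%MS); first by rewrite sub_capmx yW.
rewrite -(mxrank_leqif_sup s); apply/eqP/anti_leq; rewrite mxrankS //= rank_rV x0.
rewrite -(leq_add2l n); apply: leq_trans (leq_add tr (leqnn _)) _.
by rewrite mxrank_sum_cap [(_ + _)%N]e addn1.
Qed.

(** The cone is pointed, so [y] or [- y] lies outside it and the ray in that direction exits. The
    exit point is nonzero because [y] is not a multiple of [x]. *)
Lemma exit_line J x y : isface J -> fcone J x -> x != 0 -> (y <= gen J)%MS ->
  ~~ (y <= x)%MS -> exists t F,
    [/\ isface F, F \proper J, ripos F (x + t *: y) & x + t *: y != 0].
Proof.
move=> fJ cx x0 yJ yx.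
have nz t : x + t *: y != 0.
  have [->|t0] := eqVneq t 0; first by rewrite scale0r addr0.
  apply: contra yx; rewrite addr_eq0 => /eqP e.
  by rewrite -[y](scalerK t0) -[t *: y]opprK -e scalemx_sub // eqmx_opp.
have y0 : y != 0 by apply: contraNneq yx => ->; rewrite sub0mx.
have [cy|ny] := pselect (fcone J y).
  have [||t [F [_ fF pF rF]]] := exit_face (h := h) h_gt0 fJ cx (y := - y).
  - by rewrite eqmx_opp.
  - by move/(fcone_opp h_gt0 cy)/eqP; apply/negP.
  by exists (- t), F; split=> //; rewrite scaleNr -scalerN.
by have [t [F [_ fF pF rF]]] := exit_face h_gt0 fJ cx yJ ny; exists t, F.
Qed.

(** A second direction would lead from [x] inside [V] to a nonzero point of a proper face, whose
    rank is at most [d]. *)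
Lemma stabbed_line (k : nat) (V : 'M[R]_(k, n)) d J x y : avoids V d ->
  isface J -> rk J = d.+1 -> (x <= V)%MS -> x != 0 -> fcone J x ->
  (y <= V)%MS -> (y <= gen J)%MS -> (y <= x)%MS.
Proof.
move=> av fJ rJ xV x0 cx yV yJ; apply: contraT => yx.
have [t [F [fF pF rF /eqP[]]]] := exit_line fJ cx x0 yJ yx.
apply: av (fF) _ _ (ripos_fcone rF); first by rewrite -ltnS -rJ; apply: rk_lt.
by rewrite addmx_sub // scalemx_sub.
Qed.

(** Descent to a vertex of the slice: while the minimal face of [x] has rank above [d.+1], it meets
    [V] in dimension at least two, and moving along a second direction reaches a smaller face. *)
Lemma stabbed_exists (k : nat) (V : 'M[R]_(k, n)) d x : avoids V d ->
  (\rank V + d = n)%N -> (x <= V)%MS -> x != 0 -> fcone setT x ->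
  exists J, stabbed V d J.
Proof.
move=> av rV xV x0 /(minface h_gt0)[J fJ rx].
have [N] := ubnP (rk J); elim: N J x fJ rx xV x0 => // N IH J x fJ rx xV x0 hN.
have [rJ|rJ] := leqP (rk J) d.
  by move: x0; rewrite (av J x fJ rJ xV (ripos_fcone rx)) eqxx.
have [e|ne] := eqVneq (rk J) d.+1.
  by exists J; split=> //; exists x.
have [y [yV yJ yx]] : exists y, [/\ (y <= V)%MS, (y <= gen J)%MS & ~~ (y <= x)%MS].
  have := mxrank_sum_cap V (gen J); have := rank_leq_col (V + gen J)%MS.
  move=> h1 h2; suff: ~~ (V :&: gen J <= x)%MS.
    case/row_subPn => i hi; exists (row i (V :&: gen J)%MS).
    by have := row_sub i (V :&: gen J)%MS; rewrite sub_capmx => /andP[].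
  apply/negP => /mxrankS; rewrite rank_rV x0 => h3.
  have : (rk J <= d.+1)%N.
    by rewrite -(leq_add2l (\rank V)) -h2 addnS rV -addn1 leq_add.
  by rewrite leq_eqVlt (negPf ne) ltnS leqNgt rJ.
have [t [F [fF pF rF z0]]] := exit_line fJ (ripos_fcone rx) x0 yJ yx.
apply: (IH F _ fF rF) => //; first by rewrite addmx_sub // scalemx_sub.
by rewrite -ltnS; apply: leq_trans hN; rewrite ltnS rk_lt.
Qed.

Lemma notsub_same_rank J1 J2 : isface J2 -> rk J2 = rk J1 -> J2 != J1 ->
  exists2 i, i \in J2 & i \notin J1.
Proof.
move=> f2 e ne; apply/subsetPn; apply: contra ne => s.
by apply/eqP; apply: face_eq f2 s e.
Qed.

(* an edge of the polytope [V :&: P] has a second endpoint *)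
Lemma stabbed_neighbour (k : nat) (V : 'M[R]_(k, n)) d J J' : avoids V d ->
  (\rank V + d = n)%N -> stabbed V d J -> isface J' -> J \subset J' ->
  rk J' = d.+2 -> exists J2, [/\ stabbed V d J2, J2 \subset J' & J2 != J].
Proof.
move=> av rV [fJ rJ [x [xV x0 rx]]] fJ' s rJ'.
have tr : (1%:M <= V + gen J)%MS.
  apply: (@line_transversal _ _ _ x); first by rewrite rJ addnS rV.
  by move=> y; apply: (stabbed_line av fJ rJ) => //; apply: ripos_fcone.
have [i iJ' iJ] : exists2 i, i \in J' & i \notin J.
  by apply/subsetPn/negP => /(rkS v); rewrite rJ rJ' ltnn.
have [lJ [lJ0 JE]] := fJ.
have lz a : (a <= gen J)%MS -> ev lJ a = 0.
  by apply: ev_gen0 => j; rewrite JE => /eqP.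
have li : 0 < ev lJ (v i) by rewrite lt_neqAle eq_sym -JE iJ lJ0.
(* Transversality splits [v i] into a part in [V] and a part in the span of [J]. Adding a large
   multiple of the interior point [x] to the first part brings it into the cone of [J']. *)
have [[u1 u2] /= e] := sub_addsmxP (submx_trans (submx1 (v i)) tr).
have uJ : (- (u2 *m gen J) <= gen J)%MS by rewrite eqmx_opp submxMl.
have [N N0 rN] := ripos_absorb_large rx uJ.
pose y := u1 *m V + N *: x.
have cy : fcone J' y.
  have -> : y = v i + (N *: x - u2 *m gen J) by rewrite e /y addrACA subrr addr0.
  by apply: fconeD; [apply: fcone_v|apply: fconeS s _; apply: ripos_fcone].
have ly : ev lJ y = ev lJ (v i).
  by rewrite e /y !linearD linearZ /= (lz x) ?ripos_gen // (lz (u2 *m _)) ?submxMl // mulr0.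
(* The ray from [y] in direction [- x] must leave the pointed cone. The functional [lJ] keeps its
   positive value along it, so the exit point is nonzero and off [J]. *)
have [||t [F [t0 fF pF rF]]] := exit_face h_gt0 fJ' cy (y := - x).
- by rewrite eqmx_opp (submx_trans (ripos_gen rx)) // gen_subset.
- by move/(fcone_opp h_gt0 (fconeS s (ripos_fcone rx)))/eqP; apply/negP.
set z := y + _ in rF.
have lzz : ev lJ z = ev lJ (v i).
  by rewrite /z linearD linearZ linearN /= ly (lz x) ?ripos_gen // oppr0 mulr0 addr0.
have z0 : z != 0 by apply: contraTneq li => z0; rewrite -lzz z0 linear0 ltxx.
have zV : (z <= V)%MS.
  by rewrite !addmx_sub ?submxMl // scalemx_sub // eqmx_opp.
exists F; split; last first.
- apply: contraTneq li => eF; rewrite -lzz lz ?ltxx // -eF.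
  exact: ripos_gen.
- exact: proper_sub.
split=> //; last by exists z.
apply/anti_leq; rewrite -ltnS -rJ' rk_lt //= ltnNge; apply: contra z0 => rF'.
by apply/eqP; apply: av fF rF' zV (ripos_fcone rF).
Qed.

(** Modulo the span of [J], the span of [J'] is a line on which [lJ] is a coordinate. With [a] and
    [b] the values of [lJ] at [w] and [v i], the vector [a *: v i - b *: w] lies in the span of [J],
    where [l] vanishes. *)
Lemma cover_ratio J J2 J' l w i : isface J -> isface J2 -> rk J2 = rk J -> J2 != J ->
  J \subset J' -> J2 \subset J' -> rk J' = (rk J).+1 ->
  (forall i, i \in J -> ev l (v i) = 0) -> ripos J2 w -> i \in J' ->
  exists a b, [/\ 0 < a, 0 <= b & a * ev l (v i) = b * ev l w].
Proof.
move=> [lJ [lJ0 JE]] f2 r2 n2 s s2 r' l0 rw iJ'.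
have [j j2 jJ] := notsub_same_rank f2 r2 n2.
have lj : 0 < ev lJ (v j) by rewrite lt_neqAle eq_sym -JE jJ lJ0.
have lw : 0 < ev lJ w by apply: ripos_ev_gt0 rw j2 lj.
exists (ev lJ w), (ev lJ (v i)); split=> //.
apply/eqP; rewrite -subr_eq0 -!linearZ -linearB /=; apply/eqP.
apply: (@ev_gen0 _ _ _ v J) => //.
apply: (@facet_gen _ _ _ _ J J' lJ j) => //.
- by move=> a; rewrite JE => /eqP.
- exact: (subsetP s2).
- by rewrite gt_eqF.
- rewrite addmx_sub ?eqmx_opp ?scalemx_sub ?v_gen //.
  by apply: submx_trans (ripos_gen rw) (gen_subset _ s2).
- by rewrite linearB !linearZ /= mulrC subrr.
Qed.

(** Otherwise some [l] that is not zero vanishes on [W] and [J]. Each face covering [J] contains a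
    second stabbed face, which [W] hits, so [cover_ratio] makes [l] vanish on that cover. Then
    [face_cover_ge0], for [l] and [- l], makes [l] vanish on all generators, which span the
    space. *)
Lemma hits_transversal (k p : nat) (V : 'M[R]_(k, n)) (W : 'M[R]_(p, n)) d J :
  avoids V d -> (\rank V + d = n)%N -> (forall F, stabbed V d F -> hits W F) ->
  stabbed V d J -> (1%:M <= W + gen J)%MS.
Proof.
move=> av rV hW sJ; apply: contraT => /row_subPn[r nr].
have [fJ rJ _] := sJ.
have [l [l0 lr]] := separate nr.
have lJ i : i \in J -> ev l (v i) = 0.
  by move=> /(v_gen v) s; rewrite l0 // (submx_trans s) ?addsmxSr.
have cov F : isface F -> J \subset F -> rk F = (rk J).+1 ->
    forall i, i \in F -> ev l (v i) = 0.
  move=> fF JF rF i iF.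
  have [|J2 [sJ2 J2F J2J]] := stabbed_neighbour av rV sJ fF JF; first by rewrite rF rJ.
  have [w [wW w0 rw]] := hW _ sJ2; have [f2 r2 _] := sJ2.
  have [a [b [a0 b0]]] := cover_ratio fJ f2 (etrans r2 (esym rJ)) J2J JF J2F rF lJ rw iF.
  rewrite (l0 w) ?(submx_trans wW) ?addsmxSl // mulr0 => /eqP.
  by rewrite mulf_eq0 gt_eqF //= => /eqP.
have p1 : forall i, 0 <= ev l (v i).
  by apply: (face_cover_ge0 fJ lJ) => F fF JF rF i iF; rewrite (cov F).
have p2 : forall i, 0 <= ev (- l) (v i).
  apply: (face_cover_ge0 fJ) => [i iJ|F fF JF rF i iF]; rewrite evNl.
    by rewrite lJ ?oppr0.
  by rewrite (cov F) ?oppr0.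
move: lr; rewrite (@ev_gen0 _ _ _ v setT l) ?ltxx // => [i _|].
  by apply/le_anti; rewrite p1 andbT -oppr_ge0 -evNl p2.
by apply: submx_full; rewrite -col_leq_rank [\rank _]full.
Qed.

(* The simplex method: an l-minimal vertex (after the projective normalisation by
   [h]) all of whose neighbours are in [S] is a global minimum on [W :&: P]. *)
Lemma stabbed_connected (k : nat) (W : 'M[R]_(k, n)) (r : nat)
    (S : {set {set 'I_m}}) (w : {set 'I_m} -> 'rV[R]_n) F x :
  (forall J, J \in S -> [/\ isface J, rk J = r, ripos J (w J), (w J <= W)%MS & w J != 0]) ->
  (forall J, J \in S -> (1%:M <= W + gen J)%MS) ->
  (forall J y, J \in S -> (y <= W)%MS -> (y <= gen J)%MS -> (y <= w J)%MS) ->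
  (forall J J', J \in S -> isface J' -> J \subset J' -> rk J' = r.+1 ->
     exists2 J2, J2 \in S & (J2 \subset J') && (J2 != J)) ->
  S != set0 -> isface F -> (x <= W)%MS -> fcone F x -> x != 0 ->
  exists2 J, J \in S & J \subset F.
Proof.
move=> SP tr line nb /set0Pn[J1 J1S] [l [l0 FE]] xW cx x0.
have hw J : J \in S -> 0 < ev h (w J).
  by case/SP => _ _ rw _ w0; apply: (fcone_gt0 h_gt0 (ripos_fcone rw)).
pose f J := ev l (w J) / ev h (w J).
case: (@arg_minP _ _ _ J1 (mem S) f J1S) => J JS Jmin; exists J => //.
have [fJ rJ rw wW w0] := SP J JS.
have lw0 : 0 <= ev l (w J) by apply: ev_fcone_ge0 (ripos_fcone rw).
have [e|ne] := eqVneq (ev l (w J)) 0.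
  apply/subsetP => i iJ; rewrite FE; apply/eqP.
  by apply: ripos_ev0 rw e i iJ.
have fJ0 : 0 < f J by rewrite divr_gt0 ?hw // lt_neqAle eq_sym ne.
(* Shifting by the minimal ratio makes the functional zero at [w J] and nonnegative at every other
   [w]. *)
pose l1 := l - f J *: h.
have l1E y : ev l1 y = ev l y - f J * ev h y by rewrite evDl evNl evZl.
have l1J : ev l1 (w J) = 0 by rewrite l1E /f divfK ?subrr // gt_eqF ?hw.
have l1S J2 : J2 \in S -> 0 <= ev l1 (w J2).
  move=> J2S; rewrite l1E subr_ge0 -ler_pdivlMr ?hw //.
  exact: Jmin.
have l1line y : (y <= W)%MS -> (y <= gen J)%MS -> ev l1 y = 0.
  by move=> yW yJ; case/sub_rVP: (line J y JS yW yJ) => a ->; rewrite linearZ /= l1J mulr0.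
have [[u1 u2] /= e] := sub_addsmxP (tr J JS).
(* This is [l1] after a projection to [W] along the span of [J]. As [l1] vanishes on the
   intersection of the two, [l2] agrees with [l1] on [W] and is zero on [J], so positivity need only
   be checked on the covers of [J]. *)
pose l2 := (u1 *m W) *m l1.
have l2E y : ev l2 y = ev l1 (y *m (u1 *m W)) by rewrite ev_mulmx.
have l2W y : (y <= W)%MS -> ev l2 y = ev l1 y.
  move=> yW; rewrite l2E; apply/eqP; rewrite -subr_eq0 -linearB; apply/eqP.
  apply: l1line.
    by rewrite addmx_sub ?eqmx_opp // mulmxA submxMl.
  by rewrite -{2}[y]mulmx1 e mulmxDr opprD addrA subrr add0r eqmx_opp mulmxA submxMl.
have l2J i : i \in J -> ev l2 (v i) = 0.
  move=> iJ; rewrite l2E; apply: l1line; first by rewrite mulmxA submxMl.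
  have -> : v i *m (u1 *m W) = v i - v i *m (u2 *m gen J).
    by rewrite -{2}[v i]mulmx1 e mulmxDr addrK.
  by rewrite addmx_sub ?v_gen // eqmx_opp mulmxA submxMl.
have : forall i, 0 <= ev l2 (v i).
  apply: (face_cover_ge0 fJ l2J) => J' fJ' JJ' rJ' i iJ'.
  have [|J2 J2S /andP[J2J' J2J]] := nb J J' JS fJ' JJ'; first by rewrite rJ' rJ.
  have [f2 r2 rw2 wW2 _] := SP J2 J2S.
  have [a [b [a0 b0 ab]]] :=
    cover_ratio fJ f2 (etrans r2 (esym rJ)) J2J JJ' J2J' rJ' l2J rw2 iJ'.
  by rewrite -(pmulr_rge0 _ a0) ab mulr_ge0 // l2W // l1S.
(* On [F] the functional [l] is zero, so [l1] is negative at [x]: a contradiction. *)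
move=> l20; have : 0 <= ev l2 x by apply: ev_fcone_ge0 cx.
have hx : 0 < ev h x by apply: (fcone_gt0 h_gt0 cx).
rewrite l2W // l1E (_ : ev l x = 0).
  by have := mulr_gt0 fJ0 hx; lra.
by apply: (ev_gen0 _ (fcone_gen cx)) => i; rewrite FE => /eqP.
Qed.

End Stabbing.

(** * Chow forms as determinants *)

Section CauchyBinet.
Variables (R : realType) (n p : nat).
Implicit Types (f g : {ffun 'I_p -> 'I_n}) (s : 'S_p).

Definition increasing f := [forall i : 'I_p, forall j : 'I_p, (i < j)%N ==> (f i < f j)%N].

Definition comp_perm (gs : {ffun 'I_p -> 'I_n} * 'S_p) : {ffun 'I_p -> 'I_n} :=
  [ffun i => gs.1 (gs.2 i)].

Lemma increasingP f : reflect (forall i j : 'I_p, (i < j)%N -> (f i < f j)%N) (increasing f).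
Proof.
apply: (iffP forallP) => [h i j|h i]; first by move/forallP: (h i) => /(_ j)/implyP.
by apply/forallP => j; apply/implyP; apply: h.
Qed.

Lemma increasing_inj f : increasing f -> injective f.
Proof.
move=> /increasingP h i j e; apply/val_inj/eqP; move: e => /(congr1 val) /= e.
by case: ltngtP => // /h; rewrite e ltnn.
Qed.

Lemma sorted_codom f : increasing f -> sorted (fun a b : 'I_n => (a < b)%N) (codom f).
Proof.
move=> /increasingP h; rewrite codomE.
apply: (@homo_sorted _ _ _ (fun a b : 'I_p => (a < b)%N)) => //.
by have := iota_ltn_sorted 0 p; rewrite -val_enum_ord sorted_map.
Qed.

(** The increasing factor is recovered as the sorted list of values, and then the permutation by
    injectivity. *)
Lemma comp_perm_inj gs gs' : increasing gs.1 -> increasing gs'.1 ->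
  comp_perm gs = comp_perm gs' -> gs = gs'.
Proof.
case: gs gs' => g s [g' s'] /= ig ig' /ffunP e.
have eg : g = g'.
  have : codom g = codom g'.
    apply: (@irr_sorted_eq _ (fun a b : 'I_n => (a < b)%N)).
    - by move=> a b c; apply: ltn_trans.
    - by move=> a; rewrite ltnn.
    - exact: sorted_codom.
    - exact: sorted_codom.
    move=> a; apply/codomP/codomP => -[i ->].
      by exists (s' (s^-1%g i)); have := e (s^-1%g i); rewrite !ffunE /= permKV.
    by exists (s (s'^-1%g i)); have := e (s'^-1%g i); rewrite !ffunE /= permKV.
  by rewrite !codomE => /eq_in_map eg; apply/ffunP => i; apply: eg; rewrite mem_enum.
rewrite eg; congr (_, _); apply/permP => i; apply: (increasing_inj ig').
by have := e i; rewrite !ffunE /= eg.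
Qed.

(** Sorting the list of values of [f] gives the increasing map, and the sorting permutation gives
    the other factor. *)
Lemma comp_perm_ex f : injective f -> exists gs, increasing gs.1 && (f == comp_perm gs).
Proof.
move=> fi; pose le (a b : 'I_n) := (a <= b)%N.
pose t := sort_tuple le (codom_tuple f).
have [s hs] : exists s : 'S_p, codom f = [tuple tnth (tcast (card_ord p) t) (s i) | i < p].
  have /tuple_permP[s hs] : perm_eq (tcast (card_ord p) (codom_tuple f)) (tcast (card_ord p) t).
    by rewrite !val_tcast /= perm_sym perm_sort.
  by exists s; rewrite -hs val_tcast.
have st : size t = p by rewrite size_tuple card_ord.
exists ([ffun i => tnth (tcast (card_ord p) t) i], s) => /=; apply/andP; split.
  apply/increasingP => i j ij; rewrite !ffunE !(tnth_nth (f i)) val_tcast.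
  have : sorted ltn (map val t).
    rewrite ltn_sorted_uniq_leq map_inj_uniq; last exact: val_inj.
    rewrite sort_uniq; apply/andP; split; first by apply/injectiveP.
    by rewrite sorted_map; apply: sort_sorted => a b; apply: leq_total.
  have tr : transitive (relpre (val : 'I_n -> nat) ltn) by move=> a b c; apply: ltn_trans.
  by rewrite sorted_map => /(sorted_ltn_nth tr (f i)); apply; rewrite ?inE ?st.
apply/eqP/ffunP => i; rewrite !ffunE /=.
by move: hs; rewrite codomE /= => /eq_in_map; apply; rewrite mem_enum.
Qed.

(** Cauchy-Binet formula. Expanding the product row by row gives a sum over all maps [f]; repeated
    columns kill the maps that are not injective, and the others factor uniquely as an increasing
    map after a permutation. *)
Lemma chow_valE (A B : 'M[R]_(p, n)) : chow_val A B = \det (A *m B^T).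
Proof.
pose H f := (\prod_i A i (f i)) * \det (colsub f B).
have -> : \det (A *m B^T) = \sum_f H f.
  rewrite /determinant.
  under eq_bigr => s _.
    under eq_bigr => i _ do rewrite mxE.
    rewrite bigA_distr_bigA mulr_sumr; over.
  rewrite exchange_big; apply: eq_bigr => f _.
  rewrite /H -det_tr /determinant mulr_sumr; apply: eq_bigr => s _.
  rewrite big_split /= mulrCA; congr (_ * (_ * _)).
  by apply: eq_bigr => i _; rewrite !mxE.
rewrite (bigID (fun f => injectiveb f)) /= [X in _ + X]big1 ?addr0; last first.
  move=> f /injectivePn[i [j ij e]]; rewrite /H -det_tr.
  rewrite (determinant_alternate ij) ?mulr0 // => a.
  by rewrite !mxE e.
(* The default pair is only returned for maps that are not injective, which the sum no longer
   contains. *)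
pose h' f := odflt (f, 1%g) [pick gs | increasing gs.1 && (f == comp_perm gs)].
have h'P f : injectiveb f -> increasing (h' f).1 && (f == comp_perm (h' f)).
  move/injectiveP/comp_perm_ex => [gs hgs]; rewrite /h'.
  by case: pickP => [//|/(_ gs)]; rewrite hgs.
rewrite (reindex_onto comp_perm h'); last by move=> f /h'P/andP[_ /eqP].
rewrite (eq_bigl (fun gs => increasing gs.1)); last first.
  move=> gs; apply/andP/idP => [[/h'P/andP[i _] /eqP <-] //|i].
  have ib : injectiveb (comp_perm gs).
    apply/injectiveP => a b; rewrite !ffunE => /(increasing_inj i); exact: perm_inj.
  split=> //; have /andP[i' /eqP e] := h'P _ ib.
  by apply/eqP/esym; apply: comp_perm_inj.
transitivity (\sum_(g | increasing g) \sum_s H (comp_perm (g, s))); last first.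
  rewrite pair_big /=; apply: eq_big => [[g s]|[g s] _] //=.
  by rewrite andbT.
apply: eq_bigr => g _.
rewrite [\det (colsub g A)]/determinant mulr_suml; apply: eq_bigr => s _.
have -> : H (comp_perm (g, s)) = (\prod_i A i (g (s i))) * \det (col_perm s (colsub g B)).
  rewrite /H; congr (_ * _); first by apply: eq_bigr => i _; rewrite ffunE.
  by congr determinant; apply/matrixP => i j; rewrite !mxE ffunE.
rewrite col_permE det_mulmx det_perm odd_permV.
have -> : \prod_i colsub g A i (s i) = \prod_i A i (g (s i)).
  by apply: eq_bigr => i _; rewrite mxE.
by rewrite mulrAC mulrC [_ * \det _]mulrC.
Qed.

End CauchyBinet.

(** * Determinants as volumes, and the sign of a product of two of them *)

Section ChowSigns.
Variables (R : realType) (n d : nat).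
Implicit Types (N : 'M[R]_(d, n)) (Phi Psi : 'M[R]_(n, d)).

(* [\det (col_mx N X *m pinvmx E)] is the volume of the rows of [N] and [X] in the
   basis [E] of their span. *)
Lemma det_mul_volume (p : nat) N (X : 'M[R]_(p, n)) (E : 'M[R]_(d + p, n)) Phi :
  (N <= E)%MS -> (X <= E)%MS -> X *m Phi = 0 -> row_free X ->
  \det (N *m Phi) =
    \det (col_mx N X *m pinvmx E) * \det (E *m row_mx Phi (pinvmx X)).
Proof.
move=> NE XE X0 fX; rewrite -det_mulmx mulmxA mulmxKpV; last by rewrite col_mx_sub NE.
by rewrite mul_col_row X0 det_ublock mulmxVp // det1 mulr1.
Qed.

(** Both determinants are volumes in one basis [E] of the span of [A], and passing from [X] to [Y]
    multiplies the volume by [\det T]. What matters is that [c] does not depend on [N]. *)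
Lemma det_product_sign (p q : nat) (X Y : 'M[R]_(p, n)) (A : 'M[R]_(q, n)) Phi Psi :
  \rank A = (d + p)%N -> (X <= A)%MS -> (Y <= A)%MS ->
  X *m Phi = 0 -> Y *m Psi = 0 -> row_free X -> row_free Y ->
  exists c, forall N T S, (N <= A)%MS -> Y = T *m X + S *m N ->
    exists a, \det (N *m Phi) * \det (N *m Psi) = c * \det T * a ^+ 2.
Proof.
move=> rA XA YA X0 Y0 fX fY.
have [E EA] : exists E : 'M[R]_(d + p, n), (E :=: A)%MS.
  by rewrite -rA; exists (row_base A); apply: eq_row_base.
pose c1 := \det (E *m row_mx Phi (pinvmx X)); pose c2 := \det (E *m row_mx Psi (pinvmx Y)).
exists (c1 * c2) => N T S NA YE; exists (\det (col_mx N X *m pinvmx E)).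
rewrite (@det_mul_volume p N X E) ?EA // (@det_mul_volume p N Y E) ?EA // -/c1 -/c2.
have -> : col_mx N Y = block_mx 1%:M 0 S T *m col_mx N X.
  by rewrite mul_block_col mul1mx mul0mx addr0 YE addrC.
by rewrite -mulmxA det_mulmx det_lblock det1; ring.
Qed.

Lemma det_neq0 (k : nat) (V : 'M[R]_(k, n)) N Phi :
  (forall x : 'rV_n, (x *m Phi == 0) = (x <= V)%MS) -> row_free N ->
  (\det (N *m Phi) != 0) <-> (forall y : 'rV_n, (y <= V)%MS -> (y <= N)%MS -> y = 0).
Proof.
move=> ker fN; rewrite -unitfE -[_ \is a _]/(_ \in unitmx) -row_free_unit; split.
  move=> /row_free_inj inj y; rewrite -ker => /eqP + /submxP[a e]; rewrite {}e -mulmxA => e.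
  by rewrite (inj _ a 0) ?mul0mx.
move=> h; apply/inj_row_free => a; rewrite mulmxA => /eqP; rewrite ker => /h.
by rewrite submxMl => /(_ isT) e; apply: (row_free_inj fN); rewrite mul0mx.
Qed.

End ChowSigns.

(** * Comparing signs *)

Section ChamberSigns.
Variables (R : realType) (n m d : nat) (v : 'I_m -> 'rV[R]_n).
Variables (h : 'cV[R]_n) (h_gt0 : forall i, 0 < ev h (v i)).
Hypothesis full : rk v setT = n.
Implicit Types (l : 'cV[R]_n) (x y z : 'rV[R]_n) (J F G : {set 'I_m}).
Implicit Types (N : 'M[R]_(d, n)).

Local Notation gen := (gen v).
Local Notation fcone := (fcone v).
Local Notation ripos := (ripos v).
Local Notation isface := (isface v).
Local Notation rk := (rk v).
Local Notation hits := (hits v).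
Local Notation stabbed := (stabbed v).

Definition exposes l G :=
  (forall i, 0 <= ev l (v i)) /\ forall i, (i \in G) = (ev l (v i) == 0).

Definition facet G J := [/\ isface G, rk G = d & G \subset J].

Lemma exposes_gen0 l G x : exposes l G -> (x <= gen G)%MS -> ev l x = 0.
Proof. by case=> _ GE; apply: ev_gen0 => i; rewrite GE => /eqP. Qed.

Lemma exposes_gt0 l G J x : exposes l G -> G \subset J -> (rk G < rk J)%N ->
  ripos J x -> 0 < ev l x.
Proof.
move=> [l0 GE] GJ r rx.
have [i iJ iG] : exists2 i, i \in J & i \notin G.
  by apply/subsetPn/negP => /(rkS v); rewrite leqNgt r.
by apply: ripos_ev_gt0 rx iJ _ => //; rewrite lt_neqAle eq_sym -GE iG l0.
Qed.

Lemma exposes_facet_gen l G J x : exposes l G -> G \subset J -> rk J = (rk G).+1 ->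
  (x <= gen J)%MS -> ev l x = 0 -> (x <= gen G)%MS.
Proof.
move=> [l0 GE] GJ r.
have [i iJ iG] : exists2 i, i \in J & i \notin G.
  by apply/subsetPn/negP => /(rkS v); rewrite r ltnn.
apply: facet_gen (iJ) _ => //; last by rewrite -GE.
by move=> j; rewrite GE => /eqP.
Qed.

Lemma facet_decomp l G J N x y : exposes l G -> G \subset J -> rk J = (rk G).+1 ->
  (gen G <= N)%MS -> (x <= gen J)%MS -> ev l x != 0 -> (y <= gen J)%MS ->
  exists S : 'M[R]_(1, d), y = (ev l y / ev l x) *: x + S *m N.
Proof.
move=> ex GJ r GN xJ lx yJ; pose z := y - (ev l y / ev l x) *: x.
have /submxP[S e] : (z <= N)%MS.
  apply: submx_trans GN; apply: (exposes_facet_gen ex GJ r).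
    by rewrite addmx_sub // eqmx_opp scalemx_sub.
  by rewrite linearB linearZ /= divfK ?subrr.
by exists S; rewrite -e addrC subrK.
Qed.

(** The case of [det_product_sign] with one extra row: [T] is the ratio of the values of [l] at [y]
    and [x]. The point [y] is only assumed to be in the span of [J], since its position in the cone
    is later deduced from these signs. *)
Lemma local_sign J x y (Phi Psi : 'M[R]_(n, d)) : rk J = d.+1 ->
  (x <= gen J)%MS -> (y <= gen J)%MS -> x *m Phi = 0 -> y *m Psi = 0 ->
  x != 0 -> y != 0 ->
  exists c, forall G l N, facet G J -> exposes l G -> (N :=: gen G)%MS -> ev l x != 0 ->
    exists a, \det (N *m Phi) * \det (N *m Psi) = c * (ev l y / ev l x) * a ^+ 2.
Proof.
move=> rJ xJ yJ xP yP x0 y0.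
have free (z : 'rV[R]_n) : z != 0 -> row_free z by rewrite /row_free rank_rV => ->.
have rJ' : \rank (gen J) = (d + 1)%N by rewrite addn1.
have [c hc] := det_product_sign rJ' xJ yJ xP yP (free _ x0) (free _ y0).
exists c => G l N [fG rG GJ] ex NG lx.
have r : rk J = (rk G).+1 by rewrite rJ rG.
have [|S e] := facet_decomp ex GJ r _ xJ lx yJ (N := N); first by rewrite NG.
have [||a ->] := hc N (ev l y / ev l x)%:M S.
- by rewrite NG gen_subset.
- by rewrite mul_scalar_mx.
by exists a; rewrite det_scalar1.
Qed.

(** A functional exposing [J1] determines the coefficient of [x2], and one exposing [G] that of
    [x1]. The change from the [x] to the [y] is thus triangular modulo [N], with positive
    diagonal. *)
Lemma pair_decomp J1 J2 J' G N x1 x2 y1 y2 : isface J1 -> isface J2 ->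
  rk J1 = d.+1 -> rk J2 = d.+1 -> J2 != J1 -> J1 \subset J' -> J2 \subset J' ->
  rk J' = d.+2 -> facet G J1 -> (N :=: gen G)%MS ->
  ripos J1 x1 -> ripos J1 y1 -> ripos J2 x2 -> ripos J2 y2 ->
  exists t1 t2 t12 S1 S2, [/\ 0 < t1, 0 < t2,
    y1 = t1 *: x1 + S1 *m N & y2 = t12 *: x1 + t2 *: x2 + S2 *m N].
Proof.
move=> [l1 ex1] f2 r1 r2 n12 s1 s2 r' [[l ex] rG GJ] NG rx1 ry1 rx2 ry2.
have rJ1 : rk J1 = (rk G).+1 by rewrite r1 rG.
have rJ' : rk J' = (rk J1).+1 by rewrite r' r1.
have lpos z : ripos J1 z -> 0 < ev l z by apply: exposes_gt0 ex GJ _; rewrite rJ1.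
have l1pos z : ripos J2 z -> 0 < ev l1 z.
  move=> rz; have [i i2 i1] := notsub_same_rank f2 (etrans r2 (esym r1)) n12.
  have [l10 E1] := ex1.
  by apply: ripos_ev_gt0 rz i2 _ => //; rewrite lt_neqAle eq_sym -E1 i1 l10.
have GN : (gen G <= N)%MS by rewrite NG.
pose t2 := ev l1 y2 / ev l1 x2.
have zJ1 : (y2 - t2 *: x2 <= gen J1)%MS.
  apply: (exposes_facet_gen ex1 s1 rJ').
    rewrite addmx_sub ?eqmx_opp ?scalemx_sub //;
      by apply: submx_trans (ripos_gen _) (gen_subset _ s2).
  by rewrite linearB linearZ /= divfK ?subrr // gt_eqF // l1pos.
have [|S1 e1] := facet_decomp ex GJ rJ1 GN (ripos_gen rx1) _ (ripos_gen ry1).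
  by rewrite gt_eqF // lpos.
have [|S2 e2] := facet_decomp ex GJ rJ1 GN (ripos_gen rx1) _ zJ1.
  by rewrite gt_eqF // lpos.
exists (ev l y1 / ev l x1), t2, (ev l (y2 - t2 *: x2) / ev l x1), S1, S2.
split=> //.
- by rewrite divr_gt0 ?lpos.
- by rewrite divr_gt0 ?l1pos.
- by rewrite addrAC -e2 subrK.
Qed.

Lemma row_free_pair J1 J2 x1 x2 : isface J1 -> isface J2 -> rk J2 = rk J1 -> J2 != J1 ->
  ripos J1 x1 -> ripos J2 x2 -> x1 != 0 -> row_free (col_mx x1 x2).
Proof.
move=> [l ex] f2 r n12 rx1 rx2 x10; apply: inj_row_free => u.
rewrite -[u]hsubmxK mul_row_col [lsubmx u]mx11_scalar [rsubmx u]mx11_scalar.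
set a := lsubmx u 0 0; set b := rsubmx u 0 0; rewrite !mul_scalar_mx => e.
have l2 : 0 < ev l x2.
  have [i i2 i1] := notsub_same_rank f2 r n12; have [l0 E] := ex.
  by apply: ripos_ev_gt0 rx2 i2 _ => //; rewrite lt_neqAle eq_sym -E i1 l0.
have b0 : b = 0.
  have := congr1 (ev l) e; rewrite linearD !linearZ /= (exposes_gen0 ex (ripos_gen rx1)).
  by rewrite mulr0 add0r linear0 => /eqP; rewrite mulf_eq0 (gt_eqF l2) orbF => /eqP.
have /eqP : a *: x1 = 0 by rewrite -e b0 scale0r addr0.
rewrite scaler_eq0 (negPf x10) orbF => /eqP ->.
by rewrite b0; apply/matrixP => i j; rewrite !mxE; case: splitP => k _; rewrite !mxE mul0rn.
Qed.

(** Two extra rows are added in the span of [J']. The matrix [T] is lower triangular for facets of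
    [J1] and upper triangular for those of [J2], with positive determinant in both cases, so one
    constant [c] serves both faces. *)
Lemma pair_sign J1 J2 J' x1 x2 y1 y2 (Phi Psi : 'M[R]_(n, d)) :
  isface J1 -> isface J2 -> rk J1 = d.+1 -> rk J2 = d.+1 -> J2 != J1 ->
  J1 \subset J' -> J2 \subset J' -> rk J' = d.+2 ->
  ripos J1 x1 -> ripos J1 y1 -> ripos J2 x2 -> ripos J2 y2 ->
  x1 *m Phi = 0 -> x2 *m Phi = 0 -> y1 *m Psi = 0 -> y2 *m Psi = 0 ->
  x1 != 0 -> y1 != 0 ->
  exists c, forall J G N, J = J1 \/ J = J2 -> facet G J -> (N :=: gen G)%MS ->
    exists t a, 0 < t /\ \det (N *m Phi) * \det (N *m Psi) = c * t * a ^+ 2.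
Proof.
move=> f1 f2 r1 r2 n12 s1 s2 r' rx1 ry1 rx2 ry2 ex1 ex2 ey1 ey2 x10 y10.
have r21 : rk J2 = rk J1 by rewrite r1 r2.
have rJ' : \rank (gen J') = (d + (1 + 1))%N by rewrite addn2.
have sub a b : ripos J1 a -> ripos J2 b -> (col_mx a b <= gen J')%MS.
  move=> ra rb; rewrite col_mx_sub.
  by rewrite (submx_trans (ripos_gen ra)) ?gen_subset // (submx_trans (ripos_gen rb)) ?gen_subset.
have [||c hc] := det_product_sign rJ' (sub _ _ rx1 rx2) (sub _ _ ry1 ry2) _ _
  (row_free_pair f1 f2 r21 n12 rx1 rx2 x10) (row_free_pair f1 f2 r21 n12 ry1 ry2 y10)
  (Phi := Phi) (Psi := Psi).
- by rewrite mul_col_mx ex1 ex2 col_mx0.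
- by rewrite mul_col_mx ey1 ey2 col_mx0.
exists c => J G N [-> | ->] fG NG.
- have [t1 [t2 [t12 [S1 [S2 [t10 t20 e1 e2]]]]]] :=
    pair_decomp f1 f2 r1 r2 n12 s1 s2 r' fG NG rx1 ry1 rx2 ry2.
  have [||a ->] := hc N (block_mx t1%:M 0 t12%:M t2%:M) (col_mx S1 S2).
  + by rewrite NG gen_subset //; case: fG => _ _ /subset_trans->.
  + rewrite mul_block_col mul0mx addr0 !mul_scalar_mx mul_col_mx add_col_mx.
    by rewrite -e1 -e2.
  by exists (t1 * t2), a; rewrite mulr_gt0 // det_lblock !det_scalar1.
- have [|t2 [t1 [t12 [S2 [S1 [t20 t10 e2 e1]]]]]] :=
    pair_decomp f2 f1 r2 r1 _ s2 s1 r' fG NG rx2 ry2 rx1 ry1; first by rewrite eq_sym.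
  have [||a ->] := hc N (block_mx t1%:M t12%:M 0 t2%:M) (col_mx S1 S2).
  + by rewrite NG gen_subset //; case: fG => _ _ /subset_trans->.
  + rewrite mul_block_col mul0mx add0r !mul_scalar_mx mul_col_mx add_col_mx.
    by rewrite -e2 [t1 *: _ + _]addrC -e1.
  by exists (t1 * t2), a; rewrite mulr_gt0 // det_ublock !det_scalar1.
Qed.

(** The line in which [V] meets the span of [J] passes through the interior point [x], at which the
    functional exposing [G] is positive; so [V] meets the span of [G] only in zero. *)
Lemma facet_det_neq0 (k : nat) (V : 'M[R]_(k, n)) (Phi : 'M[R]_(n, d)) J G N x :
  (forall z, (z *m Phi == 0) = (z <= V)%MS) -> rk J = d.+1 -> ripos J x ->
  (forall y, (y <= V)%MS -> (y <= gen J)%MS -> (y <= x)%MS) ->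
  facet G J -> (N :=: gen G)%MS -> \det (N *m Phi) != 0.
Proof.
move=> ker rJ rx line [[l ex] rG GJ] NG.
have fN : row_free N by rewrite /row_free NG -/(rk G) rG.
apply/(det_neq0 ker fN) => y yV; rewrite NG => yG.
have /sub_rVP[a e] := line y yV (submx_trans yG (gen_subset _ GJ)).
have := exposes_gen0 ex yG; rewrite e linearZ /= => /eqP; rewrite mulf_eq0.
have lx : 0 < ev l x by apply: exposes_gt0 ex GJ _ rx; rewrite rJ rG.
by rewrite (gt_eqF lx) orbF => /eqP ->; rewrite scale0r.
Qed.

Lemma facet_exists J F : isface J -> rk J = d.+1 -> isface F -> F \proper J ->
  exists G, facet G J /\ F \subset G.
Proof.
move=> fJ rJ fF pF.
have [|G [fG FG GJ rG]] := @face_interpolate _ _ _ v F J d fF fJ (proper_sub pF).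
  by rewrite -ltnS -rJ rk_lt // rJ leqnSn.
by exists G.
Qed.

(** * Stabbed faces of two subspaces against the signs of their Chow forms *)

Section TwoSubspaces.
Variables (k p : nat) (V : 'M[R]_(k, n)) (W : 'M[R]_(p, n)) (Phi Psi : 'M[R]_(n, d)).
Hypothesis V_avoids : avoids v V d.
Hypotheses (rV : (\rank V + d = n)%N) (rW : (\rank W + d = n)%N).
Hypothesis kerV : forall z : 'rV_n, (z *m Phi == 0) = (z <= V)%MS.
Hypothesis kerW : forall z : 'rV_n, (z *m Psi == 0) = (z <= W)%MS.
Variable N : {set 'I_m} -> 'M[R]_(d, n).
Hypothesis NE : forall G, isface G -> rk G = d -> (N G :=: gen G)%MS.

Let P G := \det (N G *m Phi) * \det (N G *m Psi).

Lemma stabbed_transversal J : stabbed V d J -> (1%:M <= V + gen J)%MS.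
Proof. by apply: (hits_transversal h_gt0 full V_avoids rV) => F []. Qed.

Lemma stabbed_V_line J x y : stabbed V d J -> ripos J x -> (x <= V)%MS -> x != 0 ->
  (y <= V)%MS -> (y <= gen J)%MS -> (y <= x)%MS.
Proof.
move=> [fJ rJ _] rx xV x0.
exact: (stabbed_line h_gt0 V_avoids fJ rJ xV x0 (ripos_fcone rx)).
Qed.

(** The stabbed faces all of whose facets have the sign of [P G1] include [J1] by [local_sign] and
    are closed under passing to neighbours by [pair_sign]. Connectedness of the slice by [V] then
    reaches [J2]. *)
Lemma chow_products_same_sign J1 J2 G1 G2 : (forall F, stabbed V d F -> hits W F) ->
  stabbed V d J1 -> stabbed V d J2 -> facet G1 J1 -> facet G2 J2 -> 0 < P G1 * P G2.
Proof.
move=> hW st1 st2 fc1 fc2.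
have Pn0 J G : stabbed V d J -> facet G J -> P G != 0.
  move=> sJ fc; have [fG rG _] := fc; have [_ rJ [x [xV x0 rx]]] := sJ.
  have [y [yW y0 ry]] := hW _ sJ; rewrite mulf_neq0 //.
    apply: (facet_det_neq0 kerV rJ rx) fc (NE fG rG) => z.
    exact: stabbed_V_line sJ rx xV x0.
  apply: (facet_det_neq0 kerW rJ ry) fc (NE fG rG).
  apply: transversal_line yW (ripos_gen ry) y0; first by rewrite [rk J]rJ addnS rW.
  exact: hits_transversal hW sJ.
have same (c t t' a a' : R) G G' : P G != 0 -> P G' != 0 -> 0 < t -> 0 < t' ->
    P G = c * t * a ^+ 2 -> P G' = c * t' * a' ^+ 2 -> 0 < P G * P G'.
  move=> n1 n2 t0 t0' e e'; rewrite lt_neqAle eq_sym mulf_neq0 //= e e'.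
  have -> : c * t * a ^+ 2 * (c * t' * a' ^+ 2) = (t * t') * (c * a * a') ^+ 2 by ring.
  by rewrite mulr_ge0 ?sqr_ge0 // mulr_ge0 // ltW.
have local J G G' : stabbed V d J -> facet G J -> facet G' J -> 0 < P G * P G'.
  move=> sJ fc fc'; have [_ rJ [x [xV x0 rx]]] := sJ.
  have [y [yW y0 ry]] := hW _ sJ.
  have [||c hc] := local_sign rJ (ripos_gen rx) (ripos_gen ry) _ _ x0 y0 (Phi := Phi) (Psi := Psi).
  - by apply/eqP; rewrite kerV.
  - by apply/eqP; rewrite kerW.
  have [[l ex] rG GJ] := fc; have [[l' ex'] rG' GJ'] := fc'.
  have lp z : ripos J z -> 0 < ev l z by apply: exposes_gt0 ex GJ _; rewrite rJ rG.
  have lp' z : ripos J z -> 0 < ev l' z by apply: exposes_gt0 ex' GJ' _; rewrite rJ rG'.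
  have [|a ea] := hc G l (N G) fc ex (NE (ex_intro _ l ex) rG); first by rewrite gt_eqF ?lp.
  have [|a' ea'] := hc G' l' (N G') fc' ex' (NE (ex_intro _ l' ex') rG').
    by rewrite gt_eqF ?lp'.
  by apply: same ea ea'; rewrite ?(Pn0 J) // divr_gt0 ?lp ?lp'.
have /choice[w hw] J : exists z, stabbed V d J -> [/\ (z <= V)%MS, z != 0 & ripos J z].
  have [[_ _ [x hx]]|ns] := pselect (stabbed V d J); last by exists 0.
  by exists x.
pose S := [set J | `[< stabbed V d J /\ forall G, facet G J -> 0 < P G1 * P G >]].
have SE J : J \in S -> stabbed V d J /\ forall G, facet G J -> 0 < P G1 * P G.
  by rewrite inE => /asboolP.
have [_ _ [x [xV x0 rx]]] := st2; have [f2 r2 _] := st2.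
have [|||||J JS JJ2] := stabbed_connected h_gt0 (W := V) (r := d.+1) (S := S) (w := w)
  _ _ _ _ _ f2 xV (ripos_fcone rx) x0.
- by move=> J /SE[sJ _]; have [f r _] := sJ; have [wV w0 rw] := hw J sJ.
- by move=> J /SE[sJ _]; apply: stabbed_transversal.
- move=> J y /SE[sJ _]; have [wV w0 rw] := hw J sJ.
  exact: stabbed_V_line.
- move=> J J' /SE[sJ PJ] fJ' JJ' rJ'.
  have [J3 [sJ3 J3J' n3]] := stabbed_neighbour h_gt0 V_avoids rV sJ fJ' JJ' rJ'.
  exists J3; last by rewrite J3J'.
  rewrite inE; apply/asboolP; split=> // G fc.
  have [f r [xa [xaV xa0 rxa]]] := sJ; have [f' r'' [xb [xbV xb0 rxb]]] := sJ3.
  have [ya [yaW ya0 rya]] := hW _ sJ; have [yb [ybW yb0 ryb]] := hW _ sJ3.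
  have [||||c hc] := pair_sign f f' r r'' n3 JJ' J3J' rJ' rxa rya rxb ryb _ _ _ _ xa0 ya0
    (Phi := Phi) (Psi := Psi).
  + by apply/eqP; rewrite kerV.
  + by apply/eqP; rewrite kerV.
  + by apply/eqP; rewrite kerW.
  + by apply/eqP; rewrite kerW.
  (* The rank of [J] is positive, so the empty face is proper and extends to some facet, which
     carries the sign from [J] over to [J3]. *)
  have [|Ga [fca _]] := facet_exists f r (isface_set0 h_gt0).
    apply: contraT; rewrite proper0 negbK => /eqP J0.
    by move: r; rewrite J0 rk_set0.
  have [fGa rGa _] := fca; have [fG rG _] := fc.
  have [t [a [t0 ea]]] := hc J Ga (N Ga) (or_introl erefl) fca (NE fGa rGa).
  have [t' [a' [t0' ea']]] := hc J3 G (N G) (or_intror erefl) fc (NE fG rG).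
  have s1 := PJ _ fca.
  have s2 := same _ _ _ _ _ _ _ (Pn0 _ _ sJ fca) (Pn0 _ _ sJ3 fc) t0 t0' ea ea'.
  rewrite -(pmulr_rgt0 _ (_ : 0 < P Ga ^+ 2)).
    by have := mulr_gt0 s1 s2; congr (_ < _); ring.
  by rewrite exprn_even_gt0 // (Pn0 J).
- by apply/set0Pn; exists J1; rewrite inE; apply/asboolP; split=> // G; apply: local.
have [sJ PJ] := SE J JS; apply: PJ; have [fJ rJ _] := sJ.
by rewrite (face_eq fJ JJ2) ?rJ ?r2.
Qed.

(** The signs at the facets of a stabbed [J] force [W] through its interior. Conversely, the faces
    stabbed by [V] form a family of vertices of the slice by [W] closed under neighbours, so by
    connectedness [W] hits no other face of this rank. *)
Lemma hits_of_signs (s : R) : (exists J, stabbed V d J) ->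
  (forall J G, stabbed V d J -> facet G J -> 0 < s * P G) ->
  forall F, isface F -> rk F = d.+1 -> hits W F <-> hits V F.
Proof.
move=> [J0 sJ0] sP.
have fex J : stabbed V d J -> exists G, facet G J.
  move=> [fJ rJ _]; have [|G [fc _]] := facet_exists fJ rJ (isface_set0 h_gt0).
    apply: contraT; rewrite proper0 negbK => /eqP e.
    by move: rJ; rewrite e rk_set0.
  by exists G.
have detW J G : stabbed V d J -> facet G J -> \det (N G *m Psi) != 0.
  by move=> sJ fc; apply: contraTneq (sP J G sJ fc) => e; rewrite /P e !mulr0 ltxx.
have hitW J : stabbed V d J -> hits W J.
  move=> sJ; have [fJ rJ [x [xV x0 rx]]] := sJ.
  have [y [yW yJ y0]] : exists y, [/\ (y <= W)%MS, (y <= gen J)%MS & y != 0].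
    have : (W :&: gen J)%MS != 0.
      rewrite -mxrank_eq0 -lt0n -(ltn_add2l (\rank (W + gen J)%MS)) addn0 mxrank_sum_cap.
      by rewrite [\rank (gen J)]rJ addnS rW ltnS rank_leq_col.
    case/rowV0Pn => y; rewrite sub_capmx => /andP[yW yJ] y0.
    by exists y.
  have [||c hc] := local_sign rJ (ripos_gen rx) yJ _ _ x0 y0 (Phi := Phi) (Psi := Psi).
  - by apply/eqP; rewrite kerV.
  - by apply/eqP; rewrite kerW.
  have pos G l : facet G J -> exposes l G -> 0 < s * c * ev l y /\ 0 < ev l x.
    move=> fc ex; have [fG rG GJ] := fc.
    have lx : 0 < ev l x by apply: exposes_gt0 ex GJ _ rx; rewrite rJ rG.
    have [|a ea] := hc G l (N G) fc ex (NE fG rG); first by rewrite gt_eqF.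
    have := sP J G sJ fc; rewrite /P ea.
    have -> : s * (c * (ev l y / ev l x) * a ^+ 2) = (s * c * ev l y) * (a ^+ 2 / ev l x) by ring.
    have [->|a0] := eqVneq a 0; first by rewrite expr0n /= mul0r mulr0 ltxx.
    by rewrite pmulr_lgt0 // divr_gt0 // exprn_even_gt0.
  (* Among the multiples of [y], this one is positive under every functional exposing a facet of
     [J]. *)
  pose z := (s * c) *: y.
  have zJ : (z <= gen J)%MS by rewrite scalemx_sub.
  have zpos G l : facet G J -> exposes l G -> 0 < ev l z.
    by move=> fc ex; have [] := pos G l fc ex; rewrite linearZ.
  have cz : fcone J z.
    apply: contrapT => nz.
    (* A ray from [x] in direction [z] leaving the cone would exit through some facet, but its
       functional is positive at [x] and at [z]. *)
    have [t [F [t0 fF pF rF]]] := exit_face h_gt0 fJ (ripos_fcone rx) zJ nz.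
    have [G [fc FG]] := facet_exists fJ rJ fF pF.
    have [[l ex] _ _] := fc.
    have [_ lx] := pos G l fc ex; have tz := mulr_ge0 t0 (ltW (zpos G l fc ex)).
    have := exposes_gen0 ex (submx_trans (ripos_gen rF) (gen_subset _ FG)).
    by apply/eqP; rewrite linearD linearZ gt_eqF //= ltr_wpDr.
  have [F fF rF] := minface h_gt0 cz.
  have FJ := face_ripos_sub fJ cz rF.
  have [e|ne] := eqVneq F J.
    exists z; split; rewrite -?e ?scalemx_sub //.
    have [G fc] := fex J sJ; have [[l ex] _ _] := fc.
    by apply: contraTneq (zpos G l fc ex) => ->; rewrite linear0 ltxx.
  have [|G [fc FG]] := facet_exists fJ rJ fF _; first by rewrite properEneq ne.
  have [[l ex] _ _] := fc; have := zpos G l fc ex.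
  by rewrite (exposes_gen0 ex (submx_trans (ripos_gen rF) (gen_subset _ FG))) ltxx.
move=> F fF rF; split; last by move=> hV; apply: hitW.
move=> [x [xW x0 rx]].
(* For [W] avoidance of small faces is not assumed; the nonzero Chow values at the facets of [J]
   replace it. *)
have lineW J y z : stabbed V d J -> (z <= W)%MS -> ripos J z ->
    (y <= W)%MS -> (y <= gen J)%MS -> (y <= z)%MS.
  move=> sJ zW rz yW yJ; have [G fc] := fex J sJ; have [fG rG GJ] := fc.
  have [_ rJ _] := sJ; have [l ex] := fG.
  have lz : 0 < ev l z by apply: exposes_gt0 ex GJ _ rz; rewrite rJ rG.
  have fN : row_free (N G) by rewrite /row_free NE // -/(rk G) rG.
  have [r0 _] := det_neq0 kerW fN.
  have /eqP : y - (ev l y / ev l z) *: z = 0.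
    apply: r0; first exact: (detW J).
      by rewrite addmx_sub // eqmx_opp scalemx_sub.
    rewrite NE //; apply: (exposes_facet_gen ex GJ); first by rewrite rJ rG.
      by rewrite addmx_sub // eqmx_opp scalemx_sub // ripos_gen.
    by rewrite linearB linearZ /= divfK ?subrr // gt_eqF.
  by rewrite subr_eq0 => /eqP ->; rewrite scalemx_sub.
have /choice[w hw] J : exists z, stabbed V d J -> [/\ (z <= W)%MS, z != 0 & ripos J z].
  have [/hitW[z hz]|ns] := pselect (stabbed V d J); last by exists 0.
  by exists z.
pose S := [set J | `[< stabbed V d J >]].
have SE J : J \in S -> stabbed V d J by rewrite inE => /asboolP.
(* Applied to the slice by [W] and a face [F] hit by [W], this gives a face stabbed by [V] inside
   [F]; equal ranks make them the same. *)
have [|||||J /SE sJ JF] := stabbed_connected h_gt0 (W := W) (r := d.+1) (S := S) (w := w)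
  _ _ _ _ _ fF xW (ripos_fcone rx) x0.
- by move=> J /SE sJ; have [f r _] := sJ; have [wV w0 rw] := hw J sJ.
- move=> J /SE sJ; have [wW w0 rw] := hw J sJ; have [_ rJ _] := sJ.
  by apply: (@line_transversal _ _ _ _ _ W J (w J)); [rewrite [rk J]rJ addnS rW|move=> y; apply: lineW].
- by move=> J y /SE sJ; have [wW w0 rw] := hw J sJ; apply: lineW.
- move=> J J' /SE sJ fJ' JJ' rJ'.
  have [J2 [sJ2 J2J' n2]] := stabbed_neighbour h_gt0 V_avoids rV sJ fJ' JJ' rJ'.
  by exists J2; [rewrite inE; apply/asboolP|rewrite J2J'].
- by apply/set0Pn; exists J0; rewrite inE; apply/asboolP.
by have [fJ rJ hJ] := sJ; rewrite -(face_eq fJ JF) // rJ rF.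
Qed.

End TwoSubspaces.
End ChamberSigns.

(** * Translation to convex sets *)

Section Bridge.
Variables (R : realType) (n m : nat) (v : 'I_m -> 'rV[R]_n).
Implicit Types (x y : 'rV[R]_n) (J G : {set 'I_m}).

Local Notation gen := (gen v).
Local Notation fcone := (fcone v).
Local Notation ripos := (ripos v).
Local Notation isface := (isface v).
Local Notation rk := (rk v).

Lemma cone_fcone : cone v = fcone setT.
Proof.
by apply/funext => x; apply/propext; split=> -[c [c0 ->]]; exists c; split=> //;
  apply: eq_bigl => i; rewrite inE.
Qed.

Lemma fcone_mem J i : isface J -> fcone J (v i) -> i \in J.
Proof.
move=> [l [l0 JE]] /fcone_gen s; rewrite JE; apply/eqP.
by apply: ev_gen0 s => j; rewrite JE => /eqP.
Qed.

Lemma face_of_fcone G J : isface G -> G \subset J -> face_of (fcone J) (fcone G).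
Proof.
move=> [l [l0 GE]] GJ; exists l; split=> [x cx|x].
  exact: (ev_fcone_ge0 _ cx).
split=> [cx|[[c [c0 ->]] e]].
  split; first exact: fconeS cx.
  by apply: (ev_gen0 _ (fcone_gen cx)) => i; rewrite GE => /eqP.
move: e; rewrite -/(ev l _) linear_sum => /psumr_eq0P e.
exists c; split=> //; rewrite [LHS]big_mkcond [RHS]big_mkcond; apply: eq_bigr => i _.
have [iG|iG] := boolP (i \in G); first by rewrite (subsetP GJ).
case: ifP => // iJ; have : ev l (c i *: v i) = 0.
  by apply: e => // j _; rewrite linearZ /= mulr_ge0.
rewrite linearZ => /eqP; rewrite mulf_eq0 -GE (negPf iG) orbF => /eqP ->.
by rewrite scale0r.
Qed.

Lemma face_of_cone F : face_of (cone v) F <-> exists2 J, isface J & F = fcone J.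
Proof.
rewrite cone_fcone; split=> [[l [l0 FE]]|[J fJ ->]]; last exact: face_of_fcone.
have vl i : 0 <= ev l (v i) by apply: l0; apply: fcone_v; rewrite inE.
pose J := [set i | ev l (v i) == 0].
have fJ : isface J by exists l; split=> // i; rewrite inE.
exists J => //; apply/funext => x; apply/propext; split.
  move/FE => [[c [c0 ->]]]; rewrite -/(ev l _) linear_sum => /psumr_eq0P e.
  exists c; split=> //; rewrite [RHS]big_mkcond; apply: eq_big => i; rewrite ?in_setT // => _.
  case: ifPn => // iJ; have : ev l (c i *: v i) = 0.
    by apply: e => [j _|]; rewrite ?in_setT // linearZ /= mulr_ge0.
  rewrite linearZ => /eqP; rewrite mulf_eq0; rewrite inE in iJ.
  by rewrite (negPf iJ) orbF => /eqP ->; rewrite scale0r.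
move=> cx; apply/FE; split; first exact: fconeS cx.
by apply: (ev_gen0 _ (fcone_gen cx)) => i; rewrite inE => /eqP.
Qed.

Lemma cone_dim_ge_fcone J r : cone_dim_ge (fcone J) r <-> (r <= rk J)%N.
Proof.
split=> [[A [fA hA]]|le].
  rewrite -(eqP fA); apply/mxrankS/row_subP => i; exact: fcone_gen.
(* The rows are the first [r] of a maximal independent set of rows of [gen J]. *)
exists (rowsub (fun i => maxrankfun (gen J) (widen_ord le i)) (gen J)); split.
  apply/inj_row_free => u.
  have fr := maxrowsub_free (gen J).
  have -> : rowsub (fun i => maxrankfun (gen J) (widen_ord le i)) (gen J)
     = (\matrix_(i < r) delta_mx 0 (widen_ord le i)) *m rowsub (maxrankfun (gen J)) (gen J).
    by apply/row_matrixP => i; rewrite row_mul rowK -rowE !row_rowsub.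
  rewrite mulmxA => e; have := row_free_inj fr (etrans e (esym (mul0mx _ _))).
  move/rowP => e'; apply/rowP => i; have := e' (widen_ord le i); rewrite !mxE (bigD1 i) //=.
  rewrite !mxE !eqxx mulr1 big1 ?addr0 // => j ji; rewrite !mxE /= -val_eqE /=.
  by rewrite eq_sym val_eqE (negPf ji) mulr0.
move=> i; rewrite row_rowsub row_gen; case: ifP => [/(fcone_v v)//|_].
exact: fcone0.
Qed.

Lemma cone_dim_fcone J r : cone_dim (fcone J) r <-> rk J = r.
Proof.
rewrite /cone_dim !cone_dim_ge_fcone; split=> [[a /negP]|->].
  by rewrite -leqNgt => b; apply/anti_leq; rewrite a b.
by rewrite leqnn ltnn.
Qed.

Lemma span_fcone J y : Defs.span (fcone J) y <-> (y <= gen J)%MS.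
Proof.
split=> [[r [A [hA /submx_trans]]]|yJ].
  by apply; apply/row_subP => i; apply: fcone_gen.
exists m, (gen J); split=> // i; rewrite row_gen.
by case: ifP => [/(fcone_v v)//|_]; apply: fcone0.
Qed.

(** From the topological side, subtracting a small multiple of the sum of all generators of [J]
    stays in the cone; adding it back makes every coefficient positive. The other side is
    [ripos_nbhs]. *)
Lemma relint_fcone J x : relint (fcone J) x <-> ripos J x.
Proof.
split=> [[cx [e [e0 he]]]|rx]; last first.
  split; first exact: ripos_fcone.
  have [e e0 he] := ripos_nbhs rx; exists e; split=> // y /span_fcone yJ ye.
  by apply/ripos_fcone/he.
pose s := - \sum_(i in J) 1 *: v i.
have sJ : (s <= gen J)%MS by rewrite eqmx_opp sum_gen.
have [a a0 ha] := small_multiple s e0.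
have [||c [c0 xs]] := he (a *: s) => //; first by apply/span_fcone; rewrite scalemx_sub.
exists (fun i => c i + a); split=> [i|]; first by rewrite ltr_wpDl.
rewrite -[x](addrK (a *: s)) xs /s scalerN opprK scaler_sumr -big_split.
by apply: eq_bigr => i _ /=; rewrite scale1r scalerDl.
Qed.

Lemma meets_relint_fcone (k : nat) (V : 'M[R]_(k, n)) J :
  meets_relint V (fcone J) <-> hits v V J.
Proof.
split=> [[x [xV [x0 /relint_fcone rx]]]|[x [xV x0 rx]]]; first by exists x.
by exists x; split=> //; split=> //; apply/relint_fcone.
Qed.

Lemma in_FV_fcone (k : nat) (V : 'M[R]_(k, n)) F : in_FV v V F <->
  exists G J, [/\ F = fcone G, stabbed v V (n - k) J & facet (n - k) v G J].
Proof.
split=> [[/face_of_cone[G fG ->] [/cone_dim_fcone rG]]|[G [J [-> [fJ rJ hJ] [fG rG GJ]]]]].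
  case=> _ [/face_of_cone[J fJ ->] [/cone_dim_fcone rJ [/meets_relint_fcone hJ [l [_ GE]]]]].
  exists G, J; split=> //; split=> //; apply/subsetP => i /(fcone_v v)/GE[cv _].
  exact: fcone_mem.
split; first by apply/face_of_cone; exists G.
split; first exact/cone_dim_fcone.
exists (fcone J); split; first by apply/face_of_cone; exists J.
split; first exact/cone_dim_fcone.
by split; [apply/meets_relint_fcone|apply: face_of_fcone].
Qed.

End Bridge.

(** * From signs of products to equivalence of sign vectors *)

Lemma sgr_eq_of_mul_gt0 (R : realType) (a b : R) : 0 < a * b -> Num.sg a = Num.sg b.
Proof.
case: (ltrgtP a 0) (ltrgtP b 0) => [ha|ha|->] [hb|hb|->]; rewrite ?mul0r ?mulr0 ?ltxx //.
- by rewrite !ltr0_sg.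
- by rewrite nmulr_rgt0 // ltNge ltW.
- by rewrite pmulr_rgt0 // ltNge ltW.
- by rewrite !gtr0_sg.
Qed.

Theorem theorem3p1 (R : realType) (n m k : nat) (v : 'I_m -> 'rV[R]_n)
  (Hpointed : pointed_gens v)
  (Hfull : cone_dim (cone v) n)
  (Hk1 : (1 <= k)%N) (Hkn : (k <= n)%N)
  (V : 'M[R]_(k, n)) (HV : row_free V) (HVmax : in_Pmax v V)
  (M : vset R n -> 'M[R]_(n - k, n)) (HM : chow_choice v M)
  (BV : 'M[R]_(n - k, n)) (HBV : kernel_is BV V) :
  forall (W : 'M[R]_(k, n)), row_free W ->
  forall (BW : 'M[R]_(n - k, n)), kernel_is BW W ->
    (stabbing v V W <-> sign_equiv v V M BV BW).
Proof.
move=> W fW BW HBW; have [h h_gt0] := Hpointed.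
have full : rk v setT = n by apply/cone_dim_fcone; rewrite -cone_fcone.
have rV : (\rank V + (n - k) = n)%N by rewrite (eqP HV) subnKC.
have rW : (\rank W + (n - k) = n)%N by rewrite (eqP fW) subnKC.
have [Vmeets Vmiss] := HVmax.
have av : avoids v V (n - k).
  move=> G x fG rG xV cx; apply: contrapT => /eqP x0.
  apply: (Vmiss (fcone v G)); first by apply/face_of_cone; exists G.
    by move/cone_dim_ge_fcone; rewrite ltnNge rG.
  by exists x.
(* The chosen vertices lie in the face and are as many as its rank, so they span it; no other
   property of the choice enters below. *)
have NE G : isface v G -> rk v G = (n - k)%N -> (M (fcone v G) :=: gen v G)%MS.
  move=> fG rG; have [||fM hM] := HM (fcone v G).
  - by apply/face_of_cone; exists G.
  - exact/cone_dim_fcone.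
  have s : (M (fcone v G) <= gen v G)%MS.
    by apply/row_subP => r; apply: fcone_gen; case: (hM r).
  apply/eqmxP; rewrite s /= -(mxrank_leqif_sup s) (eqP fM).
  by rewrite -/(rk v G) rG.
have stabbingE : stabbing v V W <-> forall J, isface v J -> rk v J = (n - k).+1 ->
    hits v W J <-> hits v V J.
  split=> [st J fJ rJ|st F /face_of_cone[J fJ ->] /cone_dim_fcone rJ].
    rewrite -!meets_relint_fcone; apply: st; last exact/cone_dim_fcone.
    by apply/face_of_cone; exists J.
  by rewrite !meets_relint_fcone; apply: st.
pose P G := \det (M (fcone v G) *m BV^T) * \det (M (fcone v G) *m BW^T).
rewrite stabbingE /sign_equiv; split=> [st|sg].
  have hW F : stabbed v V (n - k) F -> hits v W F by case=> fF rF /(st F fF rF).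
  have same J1 J2 G1 G2 := @chow_products_same_sign _ _ _ _ v h h_gt0 full _ _ V W _ _
    av rV rW HBV HBW (fun G => M (fcone v G)) NE J1 J2 G1 G2 hW.
  (* One reference facet fixes the global sign: its product decides between equal and opposite sign
     vectors. Without any such facet there is no coordinate to compare. *)
  have [[G0 [J0 [s0 fc0]]]|none] :=
    pselect (exists G J, stabbed v V (n - k) J /\ facet (n - k) v G J); last first.
    by left=> F /in_FV_fcone[G [J [_ sJ fc]]]; case: none; exists G, J.
  have [neg|pos|z] := ltrgtP (P G0) 0.
  - right=> F /in_FV_fcone[G [J [-> sJ fc]]]; rewrite !chow_valE -sgrN.
    apply: sgr_eq_of_mul_gt0; rewrite mulrN oppr_gt0 -(nmulr_rgt0 _ neg).
    exact: same s0 sJ fc0 fc.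
  - left=> F /in_FV_fcone[G [J [-> sJ fc]]]; rewrite !chow_valE.
    apply: sgr_eq_of_mul_gt0; rewrite -(pmulr_rgt0 _ pos).
    exact: same s0 sJ fc0 fc.
  - by have := same _ _ _ _ s0 s0 fc0 fc0; rewrite -/(P G0) z mul0r ltxx.
have detV J G : stabbed v V (n - k) J -> facet (n - k) v G J ->
    \det (M (fcone v G) *m BV^T) != 0.
  move=> sJ fc; have [fJ rJ [x [xV x0 rx]]] := sJ; have [fG rG _] := fc.
  apply: (facet_det_neq0 HBV rJ rx) fc (NE G fG rG) => y.
  exact: (stabbed_line h_gt0 av fJ rJ xV x0 (ripos_fcone rx)).
have [J0 sJ0] : exists J, stabbed v V (n - k) J.
  have [x [xV [x0 cx]]] := Vmeets; rewrite cone_fcone in cx.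
  exact: (stabbed_exists h_gt0 av rV xV x0 cx).
(* Here [s] is the global sign, [1] for equal and [- 1] for opposite sign vectors; [detV] makes the
   inequality strict. *)
have concl s : (forall J G, stabbed v V (n - k) J -> facet (n - k) v G J -> 0 < s * P G) ->
  forall J, isface v J -> rk v J = (n - k).+1 -> hits v W J <-> hits v V J.
  exact: (hits_of_signs h_gt0 av rV rW HBV HBW (N := fun G => M (fcone v G)) NE (ex_intro _ J0 sJ0)).
have sgG J G : stabbed v V (n - k) J -> facet (n - k) v G J -> in_FV v V (fcone v G).
  by move=> sJ fc; apply/in_FV_fcone; exists G, J.
case: sg => sg.
  apply: (concl 1) => J G sJ fc; have := sg _ (sgG J G sJ fc); rewrite !chow_valE => e.
  rewrite mul1r -sgr_gt0 sgrM -e -expr2 exprn_even_gt0 //= sgr_eq0.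
  exact: detV sJ fc.
apply: (concl (- 1)) => J G sJ fc; have := sg _ (sgG J G sJ fc); rewrite !chow_valE => e.
rewrite mulN1r -sgr_gt0 sgrN sgrM -mulrN -e -expr2 exprn_even_gt0 //= sgr_eq0.
exact: detV sJ fc.
Qed.
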